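(* Let $P$ be a metric space, $X$ and $Y$ complete metric spaces, $F:P\times X\rightrightarrows Y$, $(\bar p,\bar x,\bar y)\in\operatorname{gph}F$, and let $G:P\rightrightarrows X$ be given by $G(p):=\{x\in X\mid\bar y\in F(p,x)\}$. Let $l>0$ and $\eta,\delta,\mu\in]0,+\infty]$. Suppose that $\operatorname{gph}F_p$ is closed for all $p\in B_\eta(\bar p)$. The mapping $G$ has the Aubin property at $(\bar p,\bar x)$ with rate $l$, and $\eta$, $\delta$ and $\mu$ if, for some $l'>0$, the mapping $F$ $l'$-recedes in $p$ uniformly in $x$ at $(\bar p,\bar x,\bar y)$ with $\eta$, $\delta$ and $\mu$, and one of the following conditions holds true, where $(\mathrm{R})$ stands for the requirement $$(\mathrm{R})\qquad p\in B_\eta(\bar p),\quad x\in B_{\delta+l\mu}(\bar x)\setminus F_p^{-1}(\bar y),\quad y\in F(p,x)\cap B_{l'\mu}(\bar y):$$ (i) there exists a $\gamma>0$ such that $$\limsup_{\substack{u\to x,\ v\to y,\ (u,v)\in\operatorname{gph}F_p,\ (u,v)\ne(x,y)\\ d(u,\bar x)<\delta+l\mu,\ d(v,\bar y)<l'\mu}}\frac{d(y,\bar y)-d(v,\bar y)}{d_\gamma((u,v),(x,y))}\ge\frac{l'}{l}$$ for all $p$, $x$ and $y$ satisfying $(\mathrm{R})$; (ii) $X$ and $Y$ are Banach, and there exists a $\gamma>0$ such that, with $N:=N^C$, $$d_\gamma\big((0,-y^* ),N_{\operatorname{gph}F_p}(x,y)\big)\ge\frac{l'}{l}\qquad(\ast)$$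 for all $p$, $x$ and $y$ satisfying $(\mathrm{R})$, and all $y^*\in Y^*$ satisfying $\|y^*\|=1$ and $\langle y^*,y-\bar y\rangle=\|y-\bar y\|$; (iii) $X$ and $Y$ are Asplund, and there exist a $\gamma>0$ and a $\tau\in]0,1[$ such that $(\ast)$ is satisfied with $N:=N^F$ for all $p$, $x$ and $y$ satisfying $(\mathrm{R})$, and all $y^*\in Y^*$ satisfying $\|y^*\|=1$ and $\langle y^*,y-\bar y\rangle>\tau\|y-\bar y\|$; (iv) $X$ and $Y$ are Banach, and $$d\big(0,D^*F_p(x,y)(B_\eta(y^* ))\big)\ge\frac{l'}{l}\qquad(\ast\ast)$$ with $D^*:=D^*_C$ for all $p$, $x$ and $y$ satisfying $(\mathrm{R})$, and all $y^*\in Y^*$ satisfying $\|y^*\|=1$ and $\langle y^*,y-\bar y\rangle=\|y-\bar y\|$; (v) $X$ and $Y$ are Asplund, and there exists a $\tau\in]0,1[$ such that $(\ast\ast)$ is satisfied with $D^*:=D^*_F$ for all $p$, $x$ and $y$ satisfying $(\mathrm{R})$, and all $y^*\in Y^*$ satisfying $\|y^*\|=1$ and $\langle y^*,y-\bar y\rangle>\tau\|y-\bar y\|$.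
   Context: $B_r(z)$ denotes the open ball with center $z$ and radius $r\in]0,+\infty]$ (also in dual spaces). $d(z,\emptyset)=+\infty$. For $p\in P$, $F_p:=F(p,\cdot)$, $\operatorname{gph}F_p=\{(x,y)\mid y\in F(p,x)\}$, $F_p^{-1}(y)=\{x\in X\mid y\in F(p,x)\}$; $\operatorname{gph}F=\{(p,x,y)\mid y\in F(p,x)\}$. Aubin property: $G$ has the Aubin property at $(\bar p,\bar x)\in\operatorname{gph}G$ with rate $l>0$, and $\eta,\delta,\mu$ if $d(x,G(p))\le l\,d(p,p')$ for all $p,p'\in B_\eta(\bar p)$ with $d(p,p')<\mu$, and all $x\in G(p')\cap B_\delta(\bar x)$. Recession: for $l'>0$, $F$ $l'$-recedes in $p$ uniformly in $x$ at $(\bar p,\bar x,\bar y)$ with $\eta,\delta,\mu$ if $d(\bar y,F(p,x))\le l'd(p,p')$ for all $x\in B_\delta(\bar x)$ and $p,p'\in B_\eta(\bar p)$ with $d(p,p')<\mu$ and $\bar y\in F(p',x)$. For $\gamma>0$: on $X\times Y$, $d_\gamma((u,v),(x,y)):=\max\{d(u,x),\gamma d(v,y)\}$; on $X^*\times Y^*$ (normed case), $d_\gamma$ is the distance induced by $\|(x^*,y^* )\|_\gamma=\|x^*\|+\gamma^{-1}\|y^*\|$. An upper limit over an empty set of $(u,v)$ is understood as $-\infty$. Fréchet normal cone to $\Omega$ at $\bar z\in\Omega$: $N^F_\Omega(\bar z)=\{z^*\mid\limsup_{\Omega\ni z\to\bar z,\,z\ne\bar z}\frac{\langle z^*,z-\bar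 z\rangle}{\|z-\bar z\|}\le0\}$. Clarke tangent cone $T^C_\Omega(\bar z)$: the set of $w$ such that for all sequences $z_k\to\bar z$ in $\Omega$ and $t_k\downarrow0$ there exist $w_k\to w$ with $z_k+t_kw_k\in\Omega$ for all $k$. Clarke normal cone: $N^C_\Omega(\bar z)=\{z^*\mid\langle z^*,w\rangle\le0\ \forall w\in T^C_\Omega(\bar z)\}$. Coderivatives of $\Phi:X\rightrightarrows Y$ at $(x,y)\in\operatorname{gph}\Phi$: $D^*\Phi(x,y)(y^* )=\{x^*\in X^*\mid(x^*,-y^* )\in N_{\operatorname{gph}\Phi}(x,y)\}$, with $N=N^C$ for $D^*_C$ and $N=N^F$ for $D^*_F$; $D^*\Phi(x,y)(V)=\bigcup_{v^*\in V}D^*\Phi(x,y)(v^* )$. A Banach space is Asplund if the dual of each of its separable subspaces is separable. *)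

(* Defs.v *)
From HB Require Import structures.
From mathcomp Require Import all_boot all_order all_algebra.
From mathcomp Require Import all_classical all_reals all_analysis.
Import Order.TTheory GRing.Theory Num.Theory.
Import numFieldNormedType.Exports.

Set Implicit Arguments.
Unset Strict Implicit.
Unset Printing Implicit Defensive.

Local Open Scope classical_set_scope.
Local Open Scope ring_scope.

#[short(type="completeMetricType")]
HB.structure Definition CompleteMetric (K : numFieldType) :=
  {M of Metric K M & Complete M}.

(* Normed modules are not metric spaces in the library. A Banach space is taken
   with its metric; no compatibility axiom is needed because the ball
   structure is shared, which forces [mdist x y = `|x - y|] (banach_mdistE). *)
#[short(type="banachType")]
HB.structure Definition Banach (K : numFieldType) :=
  {V of CompleteNormedModule K V & Metric K V}.

Section BanachMetric.
Context {R : realType}.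

Lemma banach_mdistE (V : banachType R) (x y : V) : mdist x y = `|x - y|.
Proof.
have H (e : R) : (mdist x y < e) = (`|x - y| < e).
  have := congr1 (fun A : set V => A y) (ballEmdist x e).
  rewrite -ball_normE /= => E.
  by apply/idP/idP => h; [rewrite E | rewrite -E].
by apply/eqP; rewrite eq_le !leNgt -H ltxx H ltxx.
Qed.

Section OfNormed.
Variable V : completeNormedModType R.

Let d (x y : V) : R := `|x - y|.

Let d_ge0 x y : 0 <= d x y. Proof. exact: normr_ge0. Qed.

Let d_positivity x y : d x y = 0 -> x = y.
Proof. by move/normr0_eq0/eqP; rewrite subr_eq0 => /eqP. Qed.

Let d_ball x e : ball x e = [set y | d x y < e].
Proof. by rewrite -ball_normE. Qed.

Definition banach_of_normed : banachType R :=
  HB.pack (V : Type) (CompleteNormedModule.class V)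
    (@PseudoMetric_isMetric.Build R V d d_ge0 d_positivity d_ball).

End OfNormed.
End BanachMetric.

(* d(z, A) for a distance function d; equals +oo when A is empty. *)
Definition set_dist {R : realType} {T : Type} (d : T -> T -> R) (z : T)
  (A : set T) : \bar R := ereal_inf [set (d z a)%:E | a in A].

(* Open ball with a possibly infinite radius. *)
Definition eball {R : realType} {M : metricType R} (z : M) (r : \bar R) :
  set M := [set w | ((mdist z w)%:E < r)%E].

Definition gph {X Y : Type} (Phi : X -> set Y) : set (X * Y) :=
  [set w | Phi w.1 w.2].

Section Metric.
Context {R : realType} {P X Y : metricType R}.

Definition aubin (G : P -> set X) (pbar : P) (xbar : X) (l : R)
    (eta delta mu : \bar R) : Prop :=
  forall p p' x, eball pbar eta p -> eball pbar eta p' ->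
    ((mdist p p')%:E < mu)%E -> G p' x -> eball xbar delta x ->
    (set_dist mdist x (G p) <= (l * mdist p p')%:E)%E.

Definition recedes (F : P -> X -> set Y) (pbar : P) (xbar : X) (ybar : Y)
    (l' : R) (eta delta mu : \bar R) : Prop :=
  forall x p p', eball xbar delta x -> eball pbar eta p -> eball pbar eta p' ->
    ((mdist p p')%:E < mu)%E -> F p' x ybar ->
    (set_dist mdist ybar (F p x) <= (l' * mdist p p')%:E)%E.

Definition gdist (gamma : R) (w z : X * Y) : R :=
  Num.max (mdist w.1 z.1) (gamma * mdist w.2 z.2).

Definition req (F : P -> X -> set Y) (pbar : P) (xbar : X) (ybar : Y)
    (l l' : R) (eta delta mu : \bar R) (p : P) (x : X) (y : Y) : Prop :=
  [/\ eball pbar eta p, eball xbar (delta + l%:E * mu)%E x, ~ F p x ybar,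
      F p x y & eball ybar (l'%:E * mu)%E y].

(* [limf_esup] along an improper filter is -oo, the convention wanted when
   there is no admissible (u, v) near (x, y). *)
Definition cond_slope (F : P -> X -> set Y) (pbar : P) (xbar : X) (ybar : Y)
    (l l' : R) (eta delta mu : \bar R) : Prop :=
  exists2 gamma : R, 0 < gamma &
  forall p x y, req F pbar xbar ybar l l' eta delta mu p x y ->
  ((l' / l)%:E <=
   limf_esup
     (fun w : X * Y =>
        ((mdist y ybar - mdist w.2 ybar) / gdist gamma w (x, y))%:E)
     (within [set w : X * Y | [/\ gph (F p) w, w <> (x, y),
                ((mdist w.1 xbar)%:E < delta + l%:E * mu)%E &
                ((mdist w.2 ybar)%:E < l'%:E * mu)%E]]
             (nbhs (x, y))))%E.

End Metric.

Section Normals.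
Context {R : realType}.

(* The topological dual of Z, as a set of functions. *)
Definition dual (Z : normedModType R) : set (Z -> R) :=
  [set f : Z -> R | scalar f /\ continuous f].

(* Dual norm; the supremum is finite for f in [dual Z]. *)
Definition dual_norm (Z : normedModType R) (f : Z -> R) : R :=
  sup [set `|f z| | z in [set z | `|z| <= 1]].

Definition dual_dist (Z : normedModType R) (f g : Z -> R) : R :=
  dual_norm (f \- g).

Definition dual_ball (Z : normedModType R) (f : Z -> R) (r : \bar R) :
  set (Z -> R) := [set g | dual g /\ ((dual_dist f g)%:E < r)%E].

Definition frechet_normal (Z : normedModType R) (Omega : set Z) (zbar : Z) :
    set (Z -> R) :=
  [set f : Z -> R | dual f /\
    (limf_esup (fun z => (f (z - zbar) / `|z - zbar|)%:E)
       (within [set z | Omega z /\ z <> zbar] (nbhs zbar)) <= 0)%E].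

Definition clarke_tangent (Z : normedModType R) (Omega : set Z) (zbar : Z) :
    set Z :=
  [set w | forall (z : nat -> Z) (t : nat -> R),
     (forall k, Omega (z k)) -> z @ \oo --> zbar ->
     (forall k, 0 < t k) -> t @ \oo --> (0 : R) ->
     exists2 w_ : nat -> Z, w_ @ \oo --> w &
       forall k, Omega (z k + t k *: w_ k)].

Definition clarke_normal (Z : normedModType R) (Omega : set Z) (zbar : Z) :
    set (Z -> R) :=
  [set f : Z -> R | dual f /\ forall w, clarke_tangent Omega zbar w -> f w <= 0].

Section Graph.
Context {X Y : normedModType R}.

(* The pairs of functionals (f, g) on X and Y such that (u, v) |-> f u + g v
   belongs to the set N of functionals on X * Y. *)
Definition dual_pairs (N : set (X * Y -> R)) : set ((X -> R) * (Y -> R)) :=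
  [set s | [/\ dual s.1, dual s.2 & N (fun w => s.1 w.1 + s.2 w.2)]].

(* Distance induced by the norm |f| + gamma^-1 |g| of a pair (f, g); it is dual
   to [gdist]. *)
Definition dual_gdist (gamma : R) (s t : (X -> R) * (Y -> R)) : R :=
  dual_dist s.1 t.1 + gamma^-1 * dual_dist s.2 t.2.

(* N is the normal cone operator in X x Y: Clarke's or Frechet's. *)
Definition coderivative (N : set (X * Y) -> X * Y -> set (X * Y -> R))
    (Phi : X -> set Y) (x : X) (y : Y) (ys : Y -> R) : set (X -> R) :=
  [set xs | dual_pairs (N (gph Phi) (x, y)) (xs, \- ys)].

Definition coderivative_image (N : set (X * Y) -> X * Y -> set (X * Y -> R))
    (Phi : X -> set Y) (x : X) (y : Y) (V : set (Y -> R)) : set (X -> R) :=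
  \bigcup_(vs in V) coderivative N Phi x y vs.

End Graph.

Definition separable {T : Type} (d : T -> T -> R) (A : set T) : Prop :=
  exists D : set T, [/\ countable D, D `<=` A &
    forall x, A x -> forall e : R, 0 < e -> exists2 y, D y & d x y < e].

Definition linear_subspace (Z : normedModType R) (S : set Z) : Prop :=
  S 0 /\ forall (a : R) x y, S x -> S y -> S (a *: x + y).

(* The dual of a subspace S of Z: its elements are represented by functions on
   Z of which only the values on S matter. *)
Definition dual_on (Z : normedModType R) (S : set Z) : set (Z -> R) :=
  [set f : Z -> R | (forall (a : R) x y, S x -> S y -> f (a *: x + y) = a * f x + f y) /\
           {within S, continuous f}].

Definition dual_dist_on (Z : normedModType R) (S : set Z) (f g : Z -> R) : R :=
  sup [set `|f z - g z| | z in [set z | S z /\ `|z| <= 1]].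

Definition asplund (Z : banachType R) : Prop :=
  forall S : set Z, linear_subspace S ->
    separable (fun x y : Z => `|x - y|) S ->
    separable (dual_dist_on S) (dual_on S).

End Normals.

Section BanachConditions.
Context {R : realType} {P : metricType R} {X Y : banachType R}.
Variables (F : P -> X -> set Y) (pbar : P) (xbar : X) (ybar : Y).
Variables (l l' : R) (eta delta mu : \bar R).

Definition cond_clarke_normal : Prop :=
  exists2 gamma : R, 0 < gamma &
  forall p x y (ys : Y -> R),
    req F pbar xbar ybar l l' eta delta mu p x y ->
    dual ys -> dual_norm ys = 1 -> ys (y - ybar) = `|y - ybar| ->
    ((l' / l)%:E <= set_dist (dual_gdist gamma) (cst 0, \- ys)%R
        (dual_pairs (@clarke_normal R (X * Y)%type (gph (F p)) (x, y))))%E.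

Definition cond_frechet_normal : Prop :=
  exists gamma tau : R, [/\ 0 < gamma, 0 < tau, tau < 1 &
  forall p x y (ys : Y -> R),
    req F pbar xbar ybar l l' eta delta mu p x y ->
    dual ys -> dual_norm ys = 1 -> tau * `|y - ybar| < ys (y - ybar) ->
    ((l' / l)%:E <= set_dist (dual_gdist gamma) (cst 0, \- ys)%R
        (dual_pairs (@frechet_normal R (X * Y)%type (gph (F p)) (x, y))))%E].

Definition cond_clarke_coderivative : Prop :=
  forall p x y (ys : Y -> R),
    req F pbar xbar ybar l l' eta delta mu p x y ->
    dual ys -> dual_norm ys = 1 -> ys (y - ybar) = `|y - ybar| ->
    ((l' / l)%:E <= set_dist (@dual_dist R X) (cst 0%R)
        (coderivative_image (@clarke_normal R (X * Y)%type) (F p) x y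
           (dual_ball ys eta)))%E.

Definition cond_frechet_coderivative : Prop :=
  exists tau : R, [/\ 0 < tau, tau < 1 &
  forall p x y (ys : Y -> R),
    req F pbar xbar ybar l l' eta delta mu p x y ->
    dual ys -> dual_norm ys = 1 -> tau * `|y - ybar| < ys (y - ybar) ->
    ((l' / l)%:E <= set_dist (@dual_dist R X) (cst 0%R)
        (coderivative_image (@frechet_normal R (X * Y)%type) (F p) x y
           (dual_ball ys eta)))%E].

End BanachConditions.

(* Main.v *)
Require Import Defs.
From mathcomp Require Import all_boot all_order all_algebra.
From mathcomp Require Import all_classical all_reals all_analysis.
From mathcomp Require Import ring lra.
Import Order.TTheory GRing.Theory Num.Theory.
Import numFieldNormedType.Exports.
Local Open Scope classical_set_scope.
Local Open Scope ring_scope.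

(* If the Aubin estimate fails, Ekeland's principle gives a point (x, y) of
   gph F_p satisfying (R) that minimizes d(v, ybar) + c d_gamma((u, v), (x, y))
   over gph F_p with c < l'/l; this contradicts (i). In normed spaces the
   objective is a sublinear function p of w = (v - ybar, (u, v) - (x, y)), so
   one looks for a linear f <= p that is a multiplier at the minimum. In the
   Clarke case Hahn-Banach provides it. In the Frechet case, in a separable
   subspace S with separable dual, p is the supremum of its linear minorants f;
   subtracting a small multiple of a locally uniformly rotund penalty of f makes
   the supremum Frechet differentiable, and the Borwein-Preiss principle gives
   an exact minimum nearby. The general case follows by separable reduction:
   the failure of all candidates is witnessed by finite families of points, and
   S can be closed under the choice of witnesses. (iv) and (v) are (ii) and
   (iii) for small gamma. *)

Set Implicit Arguments.
Unset Strict Implicit.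
Unset Printing Implicit Defensive.

(** * Hahn-Banach *)

(** Fréchet normals obey no exact sum rule, so the distance term and the penalty are not treated
    separately. The graph is mapped into [Y * (X * Y)] by (u, v) -> (v - ybar, (u, v) - (x, y)),
    where the objective is one sublinear function; a linear minorant there splits by coordinates
    into a functional ys for the distance and a pair (g1, g2) for the penalty. If it is nonnegative
    to first order along the graph, then -(g1, ys + g2) is normal, and its distance to (0, -ys) is
    the size of (g1, g2), about c < l'/l. Hahn-Banach is needed with side conditions [- r <= f h];
    when it fails, some finite combination of these conditions has a negative value. By a Lipschitz
    estimate such an obstruction survives a small move of the base point, so countably many chosen
    obstructions suffice for the separable reduction. In the Clarke case the minimum point does not
    move and ys norms y - ybar exactly. In the Fréchet case the point and the norm of ys are
    perturbed: (R) must be an open condition along the graph, ys has to be normalized, and the room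
    for this comes from tau < 1. *)

Section HahnBanach.
Context {R : realType} {V : lmodType R}.
Implicit Types (p q f : V -> R) (C : set (V * R)).

Definition sublinear p :=
  (forall x y, p (x + y) <= p x + p y) /\
  (forall a x, 0 <= a -> p (a *: x) = a * p x).

Lemma sublinear0 p : sublinear p -> p 0 = 0.
Proof. by case=> _ /(_ 0 0 (lexx 0)); rewrite scale0r mul0r. Qed.

Lemma sublinearN p x : sublinear p -> - p (- x) <= p x.
Proof. by move=> hp; have := hp.1 x (- x); rewrite subrr sublinear0 //; lra. Qed.

Lemma sublinearB p x y : sublinear p -> p x - p y <= p (x - y).
Proof. by move=> hp; have := hp.1 (x - y) y; rewrite subrK; lra. Qed.

(** The reverse inequality for [a] is the assumed one for [a^-1] at the point [a *: x]. *)
Lemma sublinear_of_le p :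
  (forall x y, p (x + y) <= p x + p y) ->
  (forall a x, 0 < a -> p (a *: x) <= a * p x) -> p 0 = 0 -> sublinear p.
Proof.
move=> pD pZ p0; split=> // a x; rewrite le_eqVlt => /orP[/eqP <-|a0].
  by rewrite scale0r mul0r.
apply/eqP; rewrite eq_le pZ //=.
have ai : 0 < a^-1 by rewrite invr_gt0.
have := pZ _ (a *: x) ai.
rewrite scalerA mulVf ?gt_eqF // scale1r => h.
by rewrite -(ler_pM2l ai) mulrA mulVf ?gt_eqF // mul1r.
Qed.

(** Zorn's lemma on the sublinear minorants of [p], ordered downwards. The pointwise infimum of a
    chain is finite because a minorant [t] satisfies t x >= - t (- x) >= - p (- x), and subadditive
    because of two members of a chain one lies below the other. *)
Lemma minimal_sublinear p : sublinear p ->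
  exists q, [/\ sublinear q, (forall x, q x <= p x) &
    forall q', sublinear q' -> (forall x, q' x <= q x) -> q' = q].
Proof.
move=> hp.
pose T := {q : V -> R | sublinear q /\ forall x, q x <= p x}.
pose le (s t : T) := `[< forall x, sval t x <= sval s x >].
have [||s t /asboolP st /asboolP ts||t ht] := @Zorn T le.
- by move=> t; apply/asboolP => x.
- move=> r s t /asboolP rs /asboolP st; apply/asboolP => x.
  exact: le_trans (st x) (rs x).
- case: s t st ts => [s hs] [t ht] /= st ts; apply: eq_exist.
  by apply/funext => x; apply/eqP; rewrite eq_le st ts.
- move=> A tot; have [[t0 At0]|A0] := pselect (A !=set0); last first.
    exists (exist _ p (conj hp (fun x => lexx (p x)))) => s As.
    by exfalso; apply: A0; exists s.
  pose E x := [set sval t x | t in A].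
  have lbE x : has_lbound (E x).
    exists (- p (- x)) => _ [t At <-].
    have := sublinearN x (svalP t).1; have := (svalP t).2 (- x).
    by rewrite /=; lra.
  have E0 x : E x !=set0 by exists (sval t0 x); exists t0.
  pose m x := inf (E x).
  have mle t x : A t -> m x <= sval t x.
    by move=> At; apply: (ge_inf (lbE x)); exists t.
  have hm : sublinear m.
    apply: sublinear_of_le.
    - move=> x y; apply/ler_addgt0Pl => e e0.
      have e2 : 0 < e / 2 by rewrite divr_gt0.
      have [_ [s As <-] hs] := inf_adherent e2 (conj (E0 x) (lbE x)).
      have [_ [t At <-] ht] := inf_adherent e2 (conj (E0 y) (lbE y)).
      rewrite -/(m x) in hs; rewrite -/(m y) in ht.
      case: (tot s t As At) => /asboolP st.
        have := mle t (x + y) At; have := (svalP t).1.1 x y; have := st x.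
        by rewrite /= in hs ht *; lra.
      have := mle s (x + y) As; have := (svalP s).1.1 x y; have := st y.
      by rewrite /= in hs ht *; lra.
    - move=> a x a0; rewrite -ler_pdivrMl //; apply: lb_le_inf => // _ [t At <-].
      by rewrite ler_pdivrMl // -((svalP t).1.2 _ _ (ltW a0)); apply: mle.
    - apply/eqP; rewrite eq_le; apply/andP; split.
        by have := mle _ 0 At0; rewrite (sublinear0 (svalP t0).1).
      apply: lb_le_inf => // _ [t At <-].
      by rewrite (sublinear0 (svalP t).1).
  have mp x : m x <= p x by apply: le_trans (mle _ _ At0) ((svalP t0).2 x).
  exists (exist _ m (conj hm mp)) => s As; apply/asboolP => x; exact: mle.
exists (sval t); have [sq qp] := svalP t; split=> // q' sq' q'q.
have q'p x : q' x <= p x by apply: le_trans (q'q x) (qp x).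
have /ht E : le t (exist _ q' (conj sq' q'p)) by apply/asboolP.
by rewrite -E.
Qed.

(* A minimal sublinear functional is linear: q_y(x) = inf_t q(x + t y) - t q(y)
   is sublinear and below q, hence equal to q. *)
Theorem hahn_banach p : sublinear p ->
  exists2 f : V -> R, scalar f & forall x, f x <= p x.
Proof.
move=> /minimal_sublinear [q [hq qp qmin]]; exists q => //.
have qD x y : q (x + y) = q x + q y.
  apply/eqP; rewrite eq_le hq.1 /=.
  pose E z := [set q (z + t *: y) - t * q y | t in [set t | 0 <= t]].
  have lbz z t : 0 <= t -> - q (- z) <= q (z + t *: y) - t * q y.
    move=> t0; have := hq.1 (z + t *: y) (- z).
    by rewrite addrAC subrr add0r hq.2 //; lra.
  have lbE z : has_lbound (E z) by exists (- q (- z)) => _ [t /= t0 <-]; exact: lbz.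
  have E0 z : E z !=set0 by exists (q (z + 0 *: y) - 0 * q y); exists 0 => //=.
  pose m z := inf (E z).
  have mle z t : 0 <= t -> m z <= q (z + t *: y) - t * q y.
    by move=> t0; apply: (ge_inf (lbE z)); exists t.
  have mq z : m z <= q z.
    by have := mle z 0 (lexx _); rewrite scale0r mul0r addr0 subr0.
  have hm : sublinear m.
    apply: sublinear_of_le.
    - move=> u v; apply/ler_addgt0Pl => e e0.
      have e2 : 0 < e / 2 by rewrite divr_gt0.
      have [_ [s /= s0 <-] hs] := inf_adherent e2 (conj (E0 u) (lbE u)).
      have [_ [t /= t0 <-] ht] := inf_adherent e2 (conj (E0 v) (lbE v)).
      rewrite -/(m u) in hs; rewrite -/(m v) in ht.
      have := mle (u + v) (s + t) (addr_ge0 s0 t0).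
      have := hq.1 (u + s *: y) (v + t *: y).
      by rewrite addrACA -scalerDl; lra.
    - move=> a u a0; rewrite -ler_pdivrMl //; apply: lb_le_inf => // _ [t /= t0 <-].
      have at0 : 0 <= a * t by rewrite mulr_ge0 // ltW.
      rewrite ler_pdivrMl //; apply: le_trans (mle _ _ at0) _.
      by rewrite -scalerA -scalerDr (hq.2 _ _ (ltW a0)) mulrBr mulrA.
    - apply/eqP; rewrite eq_le; apply/andP; split.
        by have := mq 0; rewrite (sublinear0 hq).
      apply: lb_le_inf => // _ [t /= t0 <-].
      by rewrite add0r hq.2 // subrr.
  have := mle x 1 ler01; rewrite (qmin _ hm mq) scale1r mul1r; lra.
have q0 := sublinear0 hq.
have qN x : q (- x) = - q x by have := qD x (- x); rewrite subrr q0; lra.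
have qZ a x : q (a *: x) = a * q x.
  have [a0|a0] := leP 0 a; first exact: hq.2.
  have a1 : 0 <= - a by rewrite oppr_ge0 ltW.
  have := hq.2 _ x a1.
  by rewrite scaleNr qN; lra.
by move=> a x y; rewrite qD qZ.
Qed.

(** The convex cone generated by [C] in the product of [V] and [R]. A pair (h, r) stands for the
    constraint f h + r >= 0 on a functional f. *)
Inductive cone_hull C : V -> R -> Prop :=
| cone_hull0 : cone_hull C 0 0
| cone_hullD a h r x s : 0 <= a -> C (h, r) -> cone_hull C x s ->
    cone_hull C (a *: h + x) (a * r + s).

Lemma cone_hull_add C x r y s :
  cone_hull C x r -> cone_hull C y s -> cone_hull C (x + y) (r + s).
Proof.
elim=> [|a h r' x' s' a0 Ch _ IH] hy; first by rewrite !add0r.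
by rewrite -!addrA; apply: cone_hullD => //; apply: IH.
Qed.

Lemma cone_hull_scale C a x r : 0 <= a ->
  cone_hull C x r -> cone_hull C (a *: x) (a * r).
Proof.
move=> a0; elim=> [|b h r' x' s' b0 Ch _ IH].
  by rewrite scaler0 mulr0; exact: cone_hull0.
by rewrite scalerDr mulrDr scalerA mulrA; apply: cone_hullD => //; rewrite mulr_ge0.
Qed.

(** The infimum of p (x + h) + r over the cone is sublinear in x, and the hypothesis bounds it below
    by - p (- x). A linear f below it satisfies f (- h) <= p 0 + r = r, which is the constraint of
    (h, r). *)
Theorem hahn_banach_cone p C : sublinear p ->
  (forall x s, cone_hull C x s -> 0 <= p x + s) ->
  exists f : V -> R, [/\ scalar f, forall x, f x <= p x &
    forall h r, C (h, r) -> - r <= f h].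
Proof.
move=> hp pC.
pose E x := [set p (x + w.1) + w.2 | w in [set w : V * R | cone_hull C w.1 w.2]].
have lbE x : has_lbound (E x).
  exists (- p (- x)) => _ [[h r] /= hr <-].
  have := hp.1 (x + h) (- x); rewrite addrAC subrr add0r.
  by have := pC _ _ hr; lra.
have E0 x : E x !=set0.
  by exists (p (x + 0) + 0); exists (0, 0) => //=; exact: cone_hull0.
pose m x := inf (E x).
have mle x h r : cone_hull C h r -> m x <= p (x + h) + r.
  by move=> hr; apply: (ge_inf (lbE x)); exists (h, r).
have mp x : m x <= p x.
  by have := mle x 0 0 (cone_hull0 _); rewrite !addr0.
have hm : sublinear m.
  apply: sublinear_of_le.
  - move=> u v; apply/ler_addgt0Pl => e e0.
    have e2 : 0 < e / 2 by rewrite divr_gt0.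
    have [_ [[h r] /= hr <-] hs] := inf_adherent e2 (conj (E0 u) (lbE u)).
    have [_ [[k t] /= kt <-] ht] := inf_adherent e2 (conj (E0 v) (lbE v)).
    rewrite -/(m u) in hs; rewrite -/(m v) in ht.
    have := mle (u + v) _ _ (cone_hull_add hr kt).
    have := hp.1 (u + h) (v + k).
    by rewrite addrACA; lra.
  - move=> a u a0; rewrite -ler_pdivrMl //; apply: lb_le_inf => // _ [[h r] /= hr <-].
    rewrite ler_pdivrMl //; apply: le_trans (mle _ _ _ (cone_hull_scale (ltW a0) hr)) _.
    by rewrite -scalerDr (hp.2 _ _ (ltW a0)) mulrDr.
  - apply/eqP; rewrite eq_le; apply/andP; split.
      by have := mp 0; rewrite (sublinear0 hp).
    apply: lb_le_inf => // _ [[h r] /= hr <-].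
    by rewrite add0r; apply: pC.
have [f lf fm] := hahn_banach hm.
exists f; split=> //; first by move=> x; apply: le_trans (fm x) (mp x).
move=> h r Ch.
have fN : f (- h) = - f h.
  have f0 : f 0 = 0.
    by have := lf (-1) 0 0; rewrite scaler0 addr0; lra.
  by have := lf (-1) h 0; rewrite scaleN1r !addr0 f0; lra.
have H : cone_hull C h r.
  by have := cone_hullD ler01 Ch (cone_hull0 C); rewrite scale1r mul1r !addr0.
have := mle (- h) _ _ H; rewrite addNr (sublinear0 hp).
by have := fm (- h); rewrite fN; lra.
Qed.

End HahnBanach.

(** * Smooth variational principle *)

Section VariationalPrinciple.
Context {R : realType} {T : Type} (d : T -> T -> R).

Definition converges (u : nat -> T) (x : T) :=
  forall e : R, 0 < e -> exists N, forall n, (N <= n)%N -> d (u n) x < e.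

Definition cauchy_seq (u : nat -> T) :=
  forall e : R, 0 < e ->
  exists N, forall m n, (N <= m)%N -> (N <= n)%N -> d (u m) (u n) < e.

Definition cauchy_complete (E : set T) :=
  forall u, (forall n, E (u n)) -> cauchy_seq u -> exists2 x, E x & converges u x.

Definition seq_lsc (E : set T) (f : T -> R) :=
  forall u x, (forall n, E (u n)) -> E x -> converges u x ->
  forall e : R, 0 < e -> exists N, forall n, (N <= n)%N -> f x <= f (u n) + e.

Lemma seq_lscD E f g : seq_lsc E f -> seq_lsc E g -> seq_lsc E (f \+ g).
Proof.
move=> hf hg u x Eu Ex ux e e0.
have e2 : 0 < e / 2 by rewrite divr_gt0.
have [N hN] := hf u x Eu Ex ux _ e2; have [M hM] := hg u x Eu Ex ux _ e2.
exists (maxn N M) => n; rewrite geq_max => /andP[/hN h1 /hM h2] /=; lra.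
Qed.

Lemma seq_lscZ E f c : 0 < c -> seq_lsc E f -> seq_lsc E (fun w => c * f w).
Proof.
move=> c0 hf u x Eu Ex ux e e0.
have ec : 0 < e / c by rewrite divr_gt0.
have [N hN] := hf u x Eu Ex ux _ ec.
exists N => n /hN h; have := ler_wpM2l (ltW c0) h.
by rewrite mulrDr mulrCA divff ?gt_eqF // mulr1.
Qed.

Lemma exists_near_minimizer (E : set T) (G : T -> R) z e : E z ->
  (exists B, forall w, E w -> B <= G w) -> 0 < e ->
  exists z', [/\ E z', G z' <= G z & forall w, E w -> G z' <= G w + e].
Proof.
move=> Ez [B GB] e0.
pose A := [set G w | w in E].
have A0 : A !=set0 by exists (G z); exists z.
have lbA : has_lbound A by exists B => _ [w Ew <-]; exact: GB.
have [_ [w Ew <-] hw] := inf_adherent e0 (conj A0 lbA).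
have lb v : E v -> inf A <= G v by move=> Ev; apply: (ge_inf lbA); exists v.
have [wz|zw] := leP (G w) (G z).
  exists w; split=> // v /lb; lra.
exists z; split=> // v /lb; lra.
Qed.

Hypothesis d_sym : forall x y, d x y = d y x.
Hypothesis d_triangle : forall y x z, d x z <= d x y + d y z.
Hypothesis d_sep : forall x y, d x y <= 0 -> x = y.

(* Borwein-Preiss; the gauge rho := d gives Ekeland's principle. *)
Theorem variational_principle (E : set T) (f : T -> R) (rho : T -> T -> R)
    (mu : nat -> R) (z0 : T) :
  cauchy_complete E -> seq_lsc E f ->
  (forall a, E a -> seq_lsc E (rho ^~ a)) ->
  (forall w a, E w -> E a -> 0 <= rho w a) ->
  (forall a, E a -> rho a a = 0) ->
  (forall r, 0 < r -> exists2 s : R, 0 < s &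
     forall w a, E w -> E a -> rho w a < s -> d w a < r) ->
  (forall i, 0 < mu i) -> (exists B, forall w, E w -> B <= f w) -> E z0 ->
  exists (z : T) (a : nat -> T),
    [/\ E z, forall i, E (a i), f z + mu 0%N * rho z z0 <= f z0 &
     forall w, E w -> exists i, forall n, (i <= n)%N ->
       f z + \sum_(j < n) mu j * rho z (a j) <=
       f w + \sum_(j < n) mu j * rho w (a j)].
Proof.
move=> Ecomp flsc rlsc r_ge0 rxx rd mu_gt0 [B fB] Ez0.
pose rad (i : nat) : R := i.+1%:R^-1.
have rad_gt0 i : 0 < rad i by rewrite invr_gt0.
have /choice [s hs] : forall i, exists s : R, 0 < s /\
    forall w a, E w -> E a -> rho w a < s -> d w a < rad i.
  by move=> i; have [s s0 h] := rd _ (rad_gt0 i); exists s.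
(* If [a i] is an [eps i]-minimizer, a competitor that is still not above it after the term
   [mu i * rho] is added has rho-distance at most [s i / 2] from it. *)
pose eps i := mu i * s i / 2.
have eps_gt0 i : 0 < eps i by rewrite divr_gt0 // mulr_gt0 //; case: (hs i).
have /choice [pk hpk] : forall x : (T -> R) * T * nat, exists z',
    E x.1.2 -> (exists B, forall w, E w -> B <= x.1.1 w) ->
    [/\ E z', x.1.1 z' <= x.1.1 x.1.2 &
      forall w, E w -> x.1.1 z' <= x.1.1 w + eps x.2].
  move=> [[G z] i] /=.
  have [Ez|nEz] := pselect (E z); last by exists z.
  have [Gb|nGb] := pselect (exists B, forall w, E w -> B <= G w); last by exists z.
  by have [z' h] := exists_near_minimizer Ez Gb (eps_gt0 i); exists z'.
pose G' i (x : (T -> R) * T) := fun w => x.1 w + mu i * rho w x.2.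
pose st := fix st n := if n is i.+1 then
  (G' i (st i), pk (G' i (st i), (st i).2, i.+1)) else (f, z0).
pose a i := (st i).2; pose F i := (st i).1.
have FS i w : F i.+1 w = F i w + mu i * rho w (a i) by [].
have inv i : E (a i) /\ forall w, E w -> B <= F i w.
  elim: i => [|i [Ea FB]]; first by split.
  have FB' w : E w -> B <= F i.+1 w.
    by move=> Ew; rewrite FS (le_trans (FB w Ew)) // lerDl mulr_ge0 ?r_ge0 // ltW.
  split=> //.
  by have [] := hpk (G' i (st i), (st i).2, i.+1) Ea (ex_intro _ B FB').
have Ea i : E (a i) by case: (inv i).
have FB i w : E w -> B <= F i w by case: (inv i) => _; apply.
have nxt i : F i.+1 (a i.+1) <= F i (a i) /\
    forall w, E w -> F i.+1 (a i.+1) <= F i.+1 w + eps i.+1.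
  have [_ h1 h2] := hpk (G' i (st i), (st i).2, i.+1) (Ea i) (ex_intro _ B (FB i.+1)).
  split; last exact: h2.
  by apply: le_trans h1 _; rewrite /= /G' -/(a i) rxx // mulr0 addr0.
have Fmono w i j : E w -> (i <= j)%N -> F i w <= F j w.
  move=> Ew /subnK <-; elim: (j - i)%N => [//|k IH].
  by rewrite addSn FS (le_trans IH) // lerDl mulr_ge0 ?r_ge0 // ltW.
have Fa i j : (i <= j)%N -> F j (a j) <= F i (a i).
  move=> /subnK <-; elim: (j - i)%N => [//|k IH].
  by rewrite addSn; apply: le_trans (nxt _).1 IH.
(* The index starts at 1 because [a 0 = z0] is not a near-minimizer. This sublevel set contains
   every later [a j] and the limit [z]. *)
have loc i w : E w -> F i.+2 w <= F i.+1 (a i.+1) -> d w (a i.+1) < rad i.+1.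
  move=> Ew h; have [s0] := hs i.+1; apply => //.
  have := (nxt i).2 w Ew; rewrite FS in h => h'.
  rewrite -(ltr_pM2l (mu_gt0 i.+1)).
  have : 0 < mu i.+1 * s i.+1 by rewrite mulr_gt0.
  by rewrite /eps in h' *; lra.
have FE i w : F i w = f w + \sum_(j < i) mu j * rho w (a j).
  elim: i => [|i IH]; first by rewrite big_ord0 addr0.
  by rewrite big_ord_recr /= addrA -IH.
have near_a i j : (i < j)%N -> F i.+1 (a j) <= F i (a i).
  move=> ij; apply: le_trans (Fmono _ _ _ (Ea j) ij) _.
  exact: Fa (ltnW ij).
have rad_small e : 0 < e -> exists i, rad i.+1 < e.
  move=> e0; have := archi_boundP (ltW (divr_gt0 ltr01 e0)).
  set n := Num.bound _ => hn; exists n.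
  rewrite /rad invf_plt ?posrE // -(div1r e) (lt_le_trans hn) // ler_nat.
  by rewrite ltnW // ltnW.
have [z Ez az] : exists2 z, E z & converges a z.
  apply: Ecomp => // e e0; have [i hi] := rad_small _ (divr_gt0 e0 (ltr0n R 2)).
  exists i.+2 => m n im jn.
  have h1 := loc i (a m) (Ea m) (near_a _ _ im).
  have h2 := loc i (a n) (Ea n) (near_a _ _ jn).
  by have := d_triangle (a i.+1) (a m) (a n); rewrite (d_sym (a i.+1)); lra.
have Fz n j : F n z <= F j (a j).
  have lscF : seq_lsc E (F n).
    elim: n => [//|n IH]; apply: seq_lscD => //.
    exact: (seq_lscZ (mu_gt0 n) (rlsc _ (Ea n))).
  apply/ler_addgt0Pl => e e0; have [N hN] := lscF a z Ea Ez az e e0.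
  pose k := maxn N (maxn n j).
  have := hN k (leq_maxl _ _).
  have := Fmono (a k) n k (Ea k); have := Fa j k.
  have nk : (n <= k)%N by rewrite /k !leq_max leqnn orbT.
  have jk : (j <= k)%N by rewrite /k !leq_max leqnn !orbT.
  by move=> /(_ jk) + /(_ nk); lra.
exists z, a; split=> //.
  by have := Fz 1%N 0%N; rewrite FS.
move=> w Ew.
(* Either [w] leaves one of the nested sublevel sets, and since the functionals only grow it stays
   above [z] from then on; or it lies in all of them and equals [z]. *)
have [[k hk]|H] := pselect (exists k, F k.+1 (a k.+1) < F k.+2 w).
  exists k.+2 => n kn; rewrite -!FE.
  apply: le_trans (Fz n k.+1) _; apply: le_trans (ltW hk) _; exact: Fmono.
suff -> : w = z by exists 0%N.
apply: d_sep; apply/ler_addgt0Pl => e e0.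
have [k hk] := rad_small _ (divr_gt0 e0 (ltr0n R 2)).
have h1 : d w (a k.+1) < rad k.+1.
  by apply: loc => //; rewrite leNgt; apply/negP => h; apply: H; exists k.
have h2 := loc k z Ez (Fz _ _).
by have := d_triangle (a k.+1) w z; rewrite (d_sym (a k.+1)) addr0; lra.
Qed.

End VariationalPrinciple.

(** * Real sequences, finite nets and suprema of images *)

Section RealSequences.
Context {R : realType}.

Lemma cauchy_real_converges (u : nat -> R) :
  cauchy_seq (fun x y => `|x - y|) u -> exists l, converges (fun x y => `|x - y|) u l.
Proof.
move=> uC.
have /cauchy_exP/cauchy_cvgP/cvg_ex [l ul] : cauchy_ex (u @ \oo).
  move=> e e0; have [N hN] := uC _ e0; exists (u N).
  exists N => // n /= Nn; rewrite -ball_normE /=; exact: hN.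
exists l => e e0.
have /cvgrPdist_lt/(_ e e0) [N _ hN] := ul.
by exists N => n /hN; rewrite distrC.
Qed.

Lemma inv_natr_small (e : R) : 0 < e -> exists n : nat, n.+1%:R^-1 < e.
Proof.
move=> e0; have := archi_boundP (ltW (divr_gt0 ltr01 e0)).
set n := Num.bound _ => hn; exists n.
by rewrite invf_plt ?posrE // -(div1r e) (lt_le_trans hn) // ler_nat.
Qed.

Lemma inv_natr_le (m n : nat) : (m <= n)%N -> n.+1%:R^-1 <= m.+1%:R^-1 :> R.
Proof. by move=> mn; rewrite lef_pV2 ?posrE ?ltr0n // ler_nat. Qed.

(** Induction on [L]: the values of the head on [D] are cut into finitely many cells of width [r],
    and a net for the tail is taken over each cell separately. *)
Lemma finite_net (T : Type) (L : seq (T -> R)) (D : set T) (r : R) : 0 < r ->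
  (forall g, List.In g L -> exists M, forall x, D x -> `|g x| <= M) ->
  exists s : seq T, (forall z, List.In z s -> D z) /\
    forall x, D x -> exists2 z, List.In z s &
      forall g, List.In g L -> `|g x - g z| <= r.
Proof.
move=> r0; elim: L D => [|g L IH] D Lb.
  have [[x0 Dx0]|D0] := pselect (D !=set0).
    exists [:: x0]; split; first by move=> z [<-|[]].
    by move=> x Dx; exists x0 => //; left.
  by exists [::]; split=> // x Dx; exfalso; apply: D0; exists x.
have [M gM] := Lb g (or_introl erefl).
pose c x := Num.truncn ((g x + M) / r).
have cb x : D x -> 0 <= (g x + M) / r.
  move=> /gM; rewrite ler_norml => /andP[h _]; apply: divr_ge0 (ltW r0); lra.
pose Dc k := [set x | D x /\ c x = k].
have /choice [sc hsc] : forall k : nat, exists s : seq T,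
    (forall z, List.In z s -> Dc k z) /\
    forall x, Dc k x -> exists2 z, List.In z s &
      forall g, List.In g L -> `|g x - g z| <= r.
  move=> k; apply: IH => f fL; have [M' h] := Lb f (or_intror fL).
  by exists M' => x [/h].
pose m := (Num.truncn ((2 * M) / r)).+1.
exists (flatten (map sc (iota 0 m))); split.
  move=> z; have : forall k j, List.In z (flatten (map sc (iota j k))) -> D z.
    elim=> [//|k IHk] j /=; rewrite List.in_app_iff => -[/(hsc j).1 []//|].
    exact: IHk.
  exact.
move=> x Dx.
have [z zs hz] := (hsc (c x)).2 x (conj Dx erefl).
have [Dz cz] := (hsc (c x)).1 z zs.
exists z.
  have cm : (c x < m)%N.
    rewrite ltnS /c; apply: Num.Theory.le_truncn.
    rewrite ler_pdivrMr // divfK ?gt_eqF //.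
    have := gM x Dx; rewrite ler_norml; lra.
  have : forall k j, (j <= c x < j + k)%N ->
      List.In z (flatten (map sc (iota j k))).
    elim=> [|k IHk] j; first by rewrite addn0 ltnNge; case: (j <= c x)%N.
    move=> /andP[jc ck] /=; rewrite List.in_app_iff.
    have [<-|] := eqVneq (c x) j; first by left.
    move=> ne; right; apply: IHk; rewrite addSnnS ck andbT ltn_neqAle jc andbT.
    by rewrite eq_sym.
  by apply; rewrite add0n cm.
move=> h [<-|]; last exact: hz.
have /andP[h1 h2] := Num.Theory.truncn_itv (cb x Dx).
have /andP[h3 h4] := Num.Theory.truncn_itv (cb z Dz).
rewrite -/(c x) in h1 h2; rewrite -/(c z) cz in h3 h4.
have h5 : (c x).+1%:R = (c x)%:R + 1 :> R by rewrite -natr1.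
have E y : g y + M = r * ((g y + M) / r) by rewrite mulrCA divff ?mulr1 // gt_eqF.
rewrite h5 in h2 h4.
have := E x; have := E z; rewrite ler_norml.
move: h1 h2 h3 h4; set A := (g x + M) / r; set B := (g z + M) / r.
move=> h1 h2 h3 h4 e1 e2.
have : r * (A - B) <= r * 1 by rewrite ler_pM2l //; lra.
have : r * (B - A) <= r * 1 by rewrite ler_pM2l //; lra.
by move=> ? ?; apply/andP; split; lra.
Qed.

Lemma le_sup_image (T : Type) (D : set T) (F : T -> R) (c : R) (x : T) :
  (forall y, D y -> F y <= c) -> D x -> F x <= sup [set F y | y in D].
Proof.
move=> Fc Dx; apply: ub_le_sup; last by exists x.
by exists c => _ [y Dy <-]; exact: Fc.
Qed.

Lemma sup_image_le (T : Type) (D : set T) (F : T -> R) (c : R) :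
  D !=set0 -> (forall y, D y -> F y <= c) -> sup [set F y | y in D] <= c.
Proof.
move=> [x Dx] Fc; apply: ge_sup; first by exists (F x); exists x.
by move=> _ [y Dy <-]; exact: Fc.
Qed.

Lemma sup_image_adherent (T : Type) (D : set T) (F : T -> R) (c e : R) :
  D !=set0 -> (forall y, D y -> F y <= c) -> 0 < e ->
  exists2 y, D y & sup [set F y | y in D] - e < F y.
Proof.
move=> [x Dx] Fc e0.
have hs : has_sup [set F y | y in D].
  split; first by exists (F x); exists x.
  by exists c => _ [y Dy <-]; exact: Fc.
by have [_ [y Dy <-] h] := sup_adherent e0 hs; exists y.
Qed.

End RealSequences.

(** * Frechet smooth convex regularization *)

Section SmoothSup.
Context {R : realType} {W : normedModType R}.
Implicit Types (S : set W) (f g : W -> R).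

Definition lin_on S f :=
  forall (a : R) x y, S x -> S y -> f (a *: x + y) = a * f x + f y.

Definition bounded_on S f := exists M, forall w, S w -> `|f w| <= M * `|w|.

Definition dense_seq S (x : nat -> W) :=
  (forall n, S (x n)) /\
  forall w, S w -> forall e : R, 0 < e -> exists n, `|w - x n| < e.

Definition dual_dense_seq S (g : nat -> W -> R) :=
  (forall n, lin_on S (g n) /\ bounded_on S (g n)) /\
  forall f, lin_on S f -> bounded_on S f -> forall e : R, 0 < e ->
  exists n, forall w, S w -> `|f w - g n w| <= e * `|w|.

Section Subspace.
Variable S : set W.
Hypothesis S_sub : linear_subspace S.

Lemma subspaceZ a x : S x -> S (a *: x).
Proof. by move=> Sx; have := S_sub.2 a x 0 Sx S_sub.1; rewrite addr0. Qed.

Lemma subspaceD x y : S x -> S y -> S (x + y).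
Proof. by move=> Sx Sy; have := S_sub.2 1 x y Sx Sy; rewrite scale1r. Qed.

Lemma subspaceN x : S x -> S (- x).
Proof. by move=> /(subspaceZ (-1)); rewrite scaleN1r. Qed.

Lemma subspaceB x y : S x -> S y -> S (x - y).
Proof. by move=> Sx /subspaceN; exact: subspaceD. Qed.

Section LinOn.
Variable f : W -> R.
Hypothesis fl : lin_on S f.

Lemma lin_on0 : f 0 = 0.
Proof. by have := fl 1 S_sub.1 S_sub.1; rewrite scaler0 addr0; lra. Qed.

Lemma lin_onZ a x : S x -> f (a *: x) = a * f x.
Proof. by move=> Sx; have := fl a Sx S_sub.1; rewrite addr0 lin_on0 addr0. Qed.

Lemma lin_onD x y : S x -> S y -> f (x + y) = f x + f y.
Proof. by move=> Sx Sy; have := fl 1 Sx Sy; rewrite scale1r mul1r. Qed.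

Lemma lin_onN x : S x -> f (- x) = - f x.
Proof. by move=> Sx; rewrite -scaleN1r lin_onZ // mulN1r. Qed.

Lemma lin_onB x y : S x -> S y -> f (x - y) = f x - f y.
Proof. by move=> Sx Sy; rewrite lin_onD ?lin_onN //; exact: subspaceN. Qed.

Lemma lin_on_le_norm (p : W -> R) M : (forall w, p w <= M * `|w|) ->
  (forall w, S w -> f w <= p w) -> forall w, S w -> `|f w| <= M * `|w|.
Proof.
move=> pM fp w Sw; rewrite ler_norml; apply/andP; split.
  have := fp _ (subspaceN Sw); rewrite lin_onN //.
  by have := pM (- w); rewrite normrN; lra.
by have := fp _ Sw; have := pM w; lra.
Qed.

End LinOn.

Lemma lin_on_limit (F : nat -> W -> R) (f : W -> R) :
  (forall k, lin_on S (F k)) ->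
  (forall u, S u -> converges (fun x y => `|x - y|) (fun k => F k u) (f u)) ->
  lin_on S f.
Proof.
move=> Fl hf.
move=> a u v Su Sv; apply/eqP; rewrite -subr_eq0 -normr_le0.
apply/ler_addgt0Pl => e e0.
have d0 : 0 < 2 + `|a| by rewrite ltr_pwDl.
have e3 := divr_gt0 e0 d0.
have Suv : S (a *: u + v) by exact: S_sub.2.
have [N1 h1] := hf _ Suv _ e3; have [N2 h2] := hf _ Su _ e3.
have [N3 h3] := hf _ Sv _ e3.
pose k := maxn N1 (maxn N2 N3).
have {}h1 := h1 k (leq_maxl _ _).
have {}h2 : `|F k u - f u| < e / (2 + `|a|).
  by apply: h2; rewrite /k !leq_max leqnn orbT.
have {}h3 : `|F k v - f v| < e / (2 + `|a|).
  by apply: h3; rewrite /k !leq_max leqnn !orbT.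
move: h1; rewrite Fl // => h1.
have -> : f (a *: u + v) - (a * f u + f v) =
  - (a * F k u + F k v - f (a *: u + v)) + a * (F k u - f u) + (F k v - f v).
  by lra.
apply: le_trans (ler_normD _ _) _.
have := ler_normD (- (a * F k u + F k v - f (a *: u + v))) (a * (F k u - f u)).
rewrite normrN normrM.
have h4 : `|a| * `|F k u - f u| <= `|a| * (e / (2 + `|a|)).
  by rewrite ler_wpM2l // ltW.
have h5 : e = 2 * (e / (2 + `|a|)) + `|a| * (e / (2 + `|a|)).
  by rewrite -mulrDl mulrC divfK // gt_eqF.
lra.
Qed.

Variables (x : nat -> W) (g : nat -> W -> R).
Hypotheses (x_dense : dense_seq S x) (g_dense : dual_dense_seq S g).
Variables (p : W -> R) (M kap : R).
Hypotheses (p_sub : sublinear p) (p_ge0 : forall w, 0 <= p w)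
  (p_le : forall w, p w <= M * `|w|) (M_gt0 : 0 < M) (kap_gt0 : 0 < kap).

Let A n := [set w | [/\ S w, `|w| <= 1 &
  forall i, (i <= n)%N -> `|g i w| <= n.+1%:R^-1]].
Let y n := (1 + `|x n|)^-1 *: x n.
Let T n f := sup [set `|f w| | w in A n].
(* The points y n detect pointwise convergence of functionals, the seminorms
   T n its uniformity: [T n f --> 0] for each f since the g i are dense. The
   parallelogram identity then makes maximizers of [f w - kap * Q f] unique and
   stable. *)
Let wt n : R := (2 ^+ n.+1)^-1.
Let part N f := \sum_(n < N) wt n * (T n f ^+ 2 + f (y n) ^+ 2).
Let Q f := sup [set part N f | N in setT].
(** [B] is a dual ball on which the penalty [Q] is finite; it contains [K], the subdifferential of
    [p] at 0 relative to [S]. *)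
Let B := [set f | lin_on S f /\ forall w, S w -> `|f w| <= M * `|w|].
Let K := [set f | lin_on S f /\ forall w, S w -> f w <= p w].

Let A0 n : A n 0.
Proof.
split; first exact: S_sub.1; first by rewrite normr0.
by move=> i _; rewrite (lin_on0 (g_dense.1 i).1) normr0 invr_ge0.
Qed.

Let Sy n : S (y n). Proof. exact: subspaceZ (x_dense.1 n). Qed.

Let y1 n : `|y n| <= 1.
Proof.
have h : 0 < 1 + `|x n| by rewrite ltr_pwDl.
by rewrite normrZ normfV gtr0_norm // mulrC ler_pdivrMr // mul1r lerDr.
Qed.

Let KB f : K f -> B f.
Proof. by move=> [fl fp]; split=> //; exact: (lin_on_le_norm fl p_le fp). Qed.

Let bnd f w : B f -> S w -> `|w| <= 1 -> `|f w| <= M.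
Proof.
move=> [_ fM] Sw w1; apply: le_trans (fM w Sw) _.
by rewrite -[leRHS]mulr1 ler_pM2l.
Qed.

Let T_ub n f w : B f -> A n w -> `|f w| <= T n f.
Proof.
move=> Bf Aw; apply: (@le_sup_image _ _ (A n) (fun w => `|f w|) M) => //.
by move=> v [Sv v1 _]; exact: bnd.
Qed.

Let T_le n f c : (forall w, A n w -> `|f w| <= c) -> T n f <= c.
Proof. by move=> h; apply: sup_image_le => //; exists 0; exact: A0. Qed.

Let T_ge0 n f : B f -> 0 <= T n f.
Proof. by move=> Bf; apply: le_trans (T_ub Bf (A0 n)). Qed.

Let T_M n f : B f -> T n f <= M.
Proof. by move=> Bf; apply: T_le => w [Sw w1 _]; exact: bnd. Qed.

Let wt_gt0 n : 0 < wt n. Proof. by rewrite invr_gt0 exprn_gt0. Qed.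

Let sum_wt N : \sum_(n < N) wt n <= 1.
Proof.
suff -> : \sum_(n < N) wt n = 1 - (2 ^+ N)^-1.
  by rewrite gerBl invr_ge0 exprn_ge0.
elim: N => [|N IH]; first by rewrite big_ord0 expr0 invr1 subrr.
rewrite big_ord_recr /= IH /wt exprS.
have : (2 : R) ^+ N != 0 by rewrite expf_neq0.
by move=> h; field.
Qed.

Let term_le n f : B f -> T n f ^+ 2 + f (y n) ^+ 2 <= 2 * M ^+ 2.
Proof.
move=> Bf; have h1 := T_ge0 n Bf; have h2 := T_M n Bf.
have h3 := bnd Bf (Sy n) (y1 n).
have : T n f ^+ 2 <= M ^+ 2 by rewrite ler_pXn2r ?nnegrE // ltW.
have : f (y n) ^+ 2 <= M ^+ 2.
  by rewrite -[f _ ^+ 2]real_normK ?num_real // ler_pXn2r ?nnegrE // ltW.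
lra.
Qed.

Let part_le N f : B f -> part N f <= 2 * M ^+ 2.
Proof.
move=> Bf; apply: (@le_trans _ _ (\sum_(n < N) wt n * (2 * M ^+ 2))).
  by apply: ler_sum => n _; rewrite ler_pM2l //; exact: term_le.
have h : 0 <= 2 * M ^+ 2 by rewrite mulr_ge0 // sqr_ge0.
by rewrite -mulr_suml -[leRHS]mul1r ler_wpM2r.
Qed.

Let part_Q N f : B f -> part N f <= Q f.
Proof.
move=> Bf; apply: (@le_sup_image _ _ setT (part ^~ f) (2 * M ^+ 2)) => // n _.
exact: part_le.
Qed.

Let Q_le f c : (forall N, part N f <= c) -> Q f <= c.
Proof. by move=> h; apply: sup_image_le => //; exists 0%N. Qed.

Let Q_ge0 f : B f -> 0 <= Q f.
Proof. by move=> Bf; apply: le_trans (part_Q 0 Bf); rewrite /part big_ord0. Qed.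

Let mid f h := fun w => (f w + h w) / 2.

Let mid_B f h : B f -> B h -> B (mid f h).
Proof.
move=> [fl fM] [hl hM]; split.
  by move=> a u v Su Sv; rewrite /mid fl // hl //; lra.
move=> w Sw; have := fM w Sw; have := hM w Sw; rewrite /mid !ler_norml; lra.
Qed.

Let gap n f h := (T n f - T n h) ^+ 2 + (f (y n) - h (y n)) ^+ 2.

(** For the point value this is the identity ((a + b) / 2)^2 + (a - b)^2 / 4 = (a^2 + b^2) / 2; for
    the seminorm [T n] it is preceded by convexity, [T n (mid f h) <= (T n f + T n h) / 2]. *)
Let term_mid n f h : B f -> B h ->
  T n (mid f h) ^+ 2 + mid f h (y n) ^+ 2 + gap n f h / 4 <=
  ((T n f ^+ 2 + f (y n) ^+ 2) + (T n h ^+ 2 + h (y n) ^+ 2)) / 2.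
Proof.
move=> Bf Bh; have Bm := mid_B Bf Bh.
have h0 := T_ge0 n Bm.
have h1 : T n (mid f h) <= (T n f + T n h) / 2.
  apply: T_le => w Aw; have := T_ub Bf Aw; have := T_ub Bh Aw.
  by rewrite /mid !ler_norml; lra.
have : T n (mid f h) ^+ 2 <= ((T n f + T n h) / 2) ^+ 2.
  by rewrite ler_pXn2r ?nnegrE // (le_trans h0).
rewrite /gap /mid; nra.
Qed.

(** Weighted sum of [term_mid] in which a single gap is kept. The partial sum is lengthened to [L]
    terms so that the index [n] occurs in it. *)
Let Q_mid n f h : B f -> B h ->
  Q (mid f h) + wt n / 4 * gap n f h <= (Q f + Q h) / 2.
Proof.
move=> Bf Bh; rewrite -lerBrDr; apply: Q_le => N; rewrite lerBrDr.
have partS k j u : B u -> part k u <= part (k + j) u.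
  move=> Bu; elim: j => [|j IH]; first by rewrite addn0.
  rewrite addnS /part big_ord_recr /= (le_trans IH) // lerDl.
  apply: mulr_ge0 (ltW (wt_gt0 _)) _; exact: addr_ge0 (sqr_ge0 _) (sqr_ge0 _).
have Bm := mid_B Bf Bh.
pose L := (N + n.+1)%N.
apply: (@le_trans _ _ (part L (mid f h) + wt n / 4 * gap n f h)).
  by rewrite lerD2r; exact: partS.
apply: (@le_trans _ _ ((part L f + part L h) / 2)); last first.
  by have := part_Q L Bf; have := part_Q L Bh; lra.
have gap0 k : 0 <= gap k f h by rewrite /gap addr_ge0 ?sqr_ge0.
have term k : wt k * (T k (mid f h) ^+ 2 + mid f h (y k) ^+ 2) +
    wt k / 4 * gap k f h <=
    (wt k * (T k f ^+ 2 + f (y k) ^+ 2) + wt k * (T k h ^+ 2 + h (y k) ^+ 2)) / 2.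
  have := term_mid k Bf Bh; rewrite -subr_ge0.
  by move=> /(mulr_ge0 (ltW (wt_gt0 k))); lra.
have nL : (n < L)%N by rewrite /L addnS ltnS leq_addl.
apply: (@le_trans _ _ (\sum_(k < L) (wt k * (T k (mid f h) ^+ 2 + mid f h (y k) ^+ 2) +
    wt k / 4 * gap k f h))).
  rewrite big_split /= lerD2l (bigD1 (Ordinal nL)) //= lerDl sumr_ge0 // => k _.
  by rewrite mulr_ge0 // divr_ge0 // ltW.
rewrite /part -big_split /= mulr_suml; apply: ler_sum => k _; exact: term.
Qed.

(** Without the penalty this supremum would be [p] itself on [S]; the penalty makes near-maximizers
    stable. *)
Let phi w := sup [set f w - kap * Q f | f in K].
Let near w e f := K f /\ phi w - e <= f w - kap * Q f.

Let K0 : K (cst 0).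
Proof. by split=> [a u v _ _|w _] /=; rewrite ?mulr0 ?addr0. Qed.

Let val_ub w f : S w -> K f -> f w - kap * Q f <= p w.
Proof.
move=> Sw Kf; have := Kf.2 w Sw; have := Q_ge0 (KB Kf).
by move=> /(mulr_ge0 (ltW kap_gt0)); lra.
Qed.

Let phi_ub w f : S w -> K f -> f w - kap * Q f <= phi w.
Proof.
move=> Sw Kf; apply: (@le_sup_image _ _ K (fun f => f w - kap * Q f) (p w)) => //.
by move=> h Kh; exact: val_ub.
Qed.

Let phi_p w : S w -> phi w <= p w.
Proof.
by move=> Sw; apply: sup_image_le => [|f Kf]; [exists (cst 0) | exact: val_ub].
Qed.

Let exists_near w e : S w -> 0 < e -> exists f, near w e f.
Proof.
move=> Sw e0.
have [|||f Kf h] := @sup_image_adherent _ _ K (fun f => f w - kap * Q f) (p w) e.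
- by exists (cst 0).
- by move=> h Kh; exact: val_ub.
- exact: e0.
by exists f; split=> //; exact: ltW.
Qed.

(** The midpoint of two near-maximizers is again in [K] and cannot beat [phi w], so the gain that
    [Q_mid] provides at the midpoint is at most [e]. *)
Let near_gap n w e f h : S w -> near w e f -> near w e h ->
  kap * (wt n / 4 * gap n f h) <= e.
Proof.
move=> Sw [Kf hf] [Kh hh].
have Km : K (mid f h).
  split; first exact: (mid_B (KB Kf) (KB Kh)).1.
  by move=> v Sv; have := Kf.2 v Sv; have := Kh.2 v Sv; rewrite /mid; lra.
have := Q_mid n (KB Kf) (KB Kh); rewrite -(ler_pM2l kap_gt0).
have := phi_ub Sw Km; rewrite /mid mulrDr mulrA mulrDr; lra.
Qed.

Let near_mono w e e' f : e <= e' -> near w e f -> near w e' f.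
Proof. by move=> ee' [Kf h]; split=> //; lra. Qed.

Let gap_small n e : 0 < e -> exists2 eta, 0 < eta & forall w f h, S w ->
  near w eta f -> near w eta h ->
  `|T n f - T n h| < e /\ `|f (y n) - h (y n)| < e.
Proof.
move=> e0; pose c := kap * (wt n / 4).
have c0 : 0 < c by rewrite mulr_gt0 // divr_gt0.
exists (c * (e ^+ 2 / 2)).
  by rewrite mulr_gt0 // divr_gt0 // exprn_gt0.
move=> w f h Sw hf hh; have := near_gap n Sw hf hh.
rewrite mulrA ler_pM2l // /gap => H.
have e2 : 0 < e ^+ 2 by rewrite exprn_gt0.
have key r : r ^+ 2 < e ^+ 2 -> `|r| < e.
  by rewrite -[r ^+ 2]real_normK ?num_real // ltr_pXn2r ?nnegrE // ltW.
have := sqr_ge0 (T n f - T n h); have := sqr_ge0 (f (y n) - h (y n)).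
by move=> ? ?; split; apply: key; lra.
Qed.

Let pt_small u e : S u -> 0 < e -> exists2 eta, 0 < eta & forall w f h, S w ->
  near w eta f -> near w eta h -> `|f u - h u| < e.
Proof.
move=> Su e0.
have M4 : 0 < 4 * M by rewrite mulr_gt0.
have [n hn] := x_dense.2 u Su _ (divr_gt0 e0 M4).
have c0 : 0 < 1 + `|x n| by rewrite ltr_pwDl.
have e2 : 0 < e / 2 by rewrite divr_gt0.
have [eta eta0 heta] := gap_small n (divr_gt0 e2 c0).
exists eta => // w f h Sw hf hh.
have [_ H] := heta w f h Sw hf hh.
have [[fl fM] [hl hM]] := (KB hf.1, KB hh.1).
have Sx := x_dense.1 n.
have Sux : S (u - x n) by exact: subspaceB.
have h3 : `|f (x n) - h (x n)| < e / 2.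
  move: H; rewrite /y (lin_onZ fl) // (lin_onZ hl) // -mulrBr normrM.
  by rewrite gtr0_norm ?invr_gt0 // mulrC ltr_pM2r // invr_gt0.
have h4 : M * `|u - x n| < e / 4.
  move: hn; rewrite ltr_pdivlMr // ltr_pdivlMr // => hn; lra.
have := fM _ Sux; have := hM _ Sux; rewrite (lin_onB fl) // (lin_onB hl) //.
move: h3; rewrite ltr_norml !ler_norml ltr_norml; lra.
Qed.

(** Completeness of the reals replaces weak-star compactness: near-maximizers of precision 1 / (k +
    1) are pointwise Cauchy by [pt_small], their limit stays in [K], and [Q] is lower semicontinuous
    along them, one partial sum at a time. *)
Let exists_max w : S w -> exists2 f, K f & phi w <= f w - kap * Q f.
Proof.
move=> Sw.
have inv0 k : 0 < k.+1%:R^-1 :> R by rewrite invr_gt0.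
have /choice [F hF] : forall k : nat, exists f, near w k.+1%:R^-1 f.
  by move=> k; exact: exists_near.
have ev (P : (W -> R) -> (W -> R) -> Prop) :
    (exists2 eta, 0 < eta & forall w f h, S w -> near w eta f -> near w eta h -> P f h) ->
    exists N, forall m n, (N <= m)%N -> (N <= n)%N -> P (F m) (F n).
  move=> [eta eta0 H]; have [N hN] := inv_natr_small eta0.
  exists N => m n Nm Nn; apply: (H w) => //.
    by apply: near_mono (hF m); apply: le_trans (inv_natr_le Nm) (ltW hN).
  by apply: near_mono (hF n); apply: le_trans (inv_natr_le Nn) (ltW hN).
have lim u : exists l, S u -> converges (fun x y => `|x - y|) (fun k => F k u) l.
  have [Su|nSu] := pselect (S u); last by exists 0.
  have [|l hl] := @cauchy_real_converges R (fun k => F k u); last by exists l.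
  by move=> e e0; apply: ev (fun f h => `|f u - h u| < e) _; exact: pt_small.
have /choice [f hf] := lim.
have fl : lin_on S f := lin_on_limit (fun k => (hF k).1.1) hf.
have Kf : K f.
  split=> // u Su; apply/ler_addgt0Pl => e e0; have [N hN] := hf u Su e e0.
  by have := hN N (leqnn _); have := (hF N).1.2 u Su; rewrite ltr_norml; lra.
exists f => //.
have Bf := KB Kf; have BF k := KB (hF k).1.
have part_lsc N e : 0 < e -> exists k0, forall k, (k0 <= k)%N ->
    part N f <= part N (F k) + e.
  elim: N e => [|n IH] e e0.
    by exists 0%N => k _; rewrite /part !big_ord0 add0r ltW.
  have e2 : 0 < e / 2 by rewrite divr_gt0.
  have [k1 hk1] := IH _ e2.
  pose c := 4 * M + 1.
  have c0 : 0 < c by rewrite /c; have := M_gt0; lra.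
  pose r := Num.min 1 (e / 2 / c).
  have r0 : 0 < r by rewrite lt_min ltr01 divr_gt0.
  have r1 : r <= 1 by rewrite ge_min lexx.
  have rc : r * c <= e / 2 by rewrite -ler_pdivlMr // ge_min lexx orbT.
  have [k2 hk2] := ev (fun f h => `|T n f - T n h| < r / 2 /\ _ < _) (gap_small n (divr_gt0 r0 (ltr0n R 2))).
  have [k3 hk3] := hf _ (Sy n) _ r0.
  exists (maxn k1 (maxn k2 k3)) => k; rewrite !geq_max => /and3P[kk1 kk2 kk3].
  (* For each [u], [f u] is close to [F m u] with m depending on [u]; the return from [T n (F m)] to
     [T n (F k)] is uniform by [gap_small]. *)
  have TF : T n f <= T n (F k) + r.
    apply: T_le => u Au; have [k4 hk4] := hf _ (let: And3 a _ _ := Au in a) _ (divr_gt0 r0 (ltr0n R 2)).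
    pose m := maxn k2 k4.
    have := hk4 m (leq_maxr _ _); have := (hk2 m k (leq_maxl _ _) kk2).1.
    have := T_ub (BF m) Au; rewrite !ler_norml !ltr_norml; lra.
  have h3 := hk3 k kk3; have h1 := hk1 k kk1.
  rewrite /part !big_ord_recr /= -/(part n f) -/(part n (F k)).
  have t0 := T_ge0 n Bf; have tk0 := T_ge0 n (BF k); have tM := T_M n (BF k).
  have bf := bnd Bf (Sy n) (y1 n); have bF := bnd (BF k) (Sy n) (y1 n).
  have s1 : T n f ^+ 2 <= T n (F k) ^+ 2 + r * (2 * M + 1).
    have : T n f ^+ 2 <= (T n (F k) + r) ^+ 2 by rewrite ler_pXn2r ?nnegrE //; lra.
    nra.
  have s2 : f (y n) ^+ 2 <= F k (y n) ^+ 2 + r * (2 * M).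
    have -> : f (y n) ^+ 2 = F k (y n) ^+ 2 +
      (f (y n) - F k (y n)) * (f (y n) + F k (y n)) by ring.
    rewrite lerD2l; apply: le_trans (ler_norm _) _; rewrite normrM ler_pM //.
      by rewrite distrC ltW.
    by apply: le_trans (ler_normD _ _) _; lra.
  have wt1 : wt n <= 1.
    by rewrite /wt invf_le1 ?exprn_gt0 // exprn_ege1 // ler1n.
  have : wt n * (T n f ^+ 2 + f (y n) ^+ 2) <=
    wt n * (T n (F k) ^+ 2 + F k (y n) ^+ 2) + wt n * (r * c).
    by rewrite -mulrDr ler_pM2l // /c; lra.
  have : wt n * (r * c) <= 1 * (r * c).
    by rewrite ler_wpM2r // mulr_ge0 // ltW.
  lra.
have QF : kap * Q f <= f w - phi w.
  rewrite -ler_pdivlMl //; apply: Q_le => N; apply/ler_addgt0Pl => e e0.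
  have e2 : 0 < e / 2 by rewrite divr_gt0.
  have ek : 0 < kap * (e / 4) by rewrite mulr_gt0 // divr_gt0.
  have [k1 h1] := part_lsc N _ e2.
  have [k2 h2] := hf w Sw _ ek.
  have [k3 h3] := inv_natr_small ek.
  pose k := maxn k1 (maxn k2 k3).
  have {}h1 := h1 k (leq_maxl _ _).
  have {}h2 : `|F k w - f w| < kap * (e / 4).
    by apply: h2; rewrite /k !leq_max leqnn orbT.
  have {}h3 : k.+1%:R^-1 <= kap * (e / 4).
    by apply: le_trans (ltW h3); apply: inv_natr_le; rewrite /k !leq_max leqnn !orbT.
  have h4 := part_Q N (BF k); have h5 := (hF k).2.
  have : Q (F k) <= kap^-1 * (f w - phi w) + e / 2.
    rewrite -(ler_pM2l kap_gt0) mulrDr mulrA divff ?gt_eqF // mul1r.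
    move: h2 h3 h5; rewrite ltr_norml; move: (k.+1%:R^-1) (phi w) (Q _) => r a b; lra.
  lra.
lra.
Qed.

(** Some [g i] lies within e / 3 of [f], and for n >= i it is at most 1 / (n + 1) on [A n]. *)
Let T_small f e : B f -> 0 < e -> exists n, T n f < e.
Proof.
move=> Bf e0; have e3 : 0 < e / 3 by rewrite divr_gt0.
have [i hi] := g_dense.2 f Bf.1 (ex_intro _ M Bf.2) _ e3.
have [j hj] := inv_natr_small e3.
exists (maxn i j); apply: (@le_lt_trans _ _ (e / 3 + e / 3)); last by lra.
apply: T_le => w [Sw w1 /(_ i (leq_maxl _ _)) gw].
have := hi w Sw.
have : e / 3 * `|w| <= e / 3 by rewrite -[leRHS]mulr1 ler_pM2l.
have := @inv_natr_le R _ _ (leq_maxr i j).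
move: gw hj; rewrite !ler_norml; move: ((maxn i j).+1%:R^-1) (j.+1%:R^-1) => r s; lra.
Qed.

(* Near-maximizers converge in norm: pointwise convergence is uniform on the
   unit ball up to a finite net modulo the almost-annihilator A n, on which all
   near-maximizers are small. *)
Let norm_small w f e : S w -> K f -> phi w <= f w - kap * Q f -> 0 < e ->
  exists2 eta, 0 < eta & forall h, near w eta h ->
    forall u, S u -> `|h u - f u| <= e * `|u|.
Proof.
move=> Sw Kf fmax e0; have Bf := KB Kf.
(* In [ball], 4/9 of [e] goes to [2 * T n h], 2/9 to [2 * T n f] and 1/9 to the net point. *)
have e9 : 0 < e / 9 by rewrite divr_gt0.
have [n hn] := T_small Bf e9.
have [eta1 eta10 h1] := gap_small n e9.
pose L := [seq g i | i <- iota 0 n.+1].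
have inL i : (i <= n)%N -> List.In (g i) L.
  move=> iN; rewrite /L; have : i \in iota 0 n.+1 by rewrite mem_iota add0n ltnS.
  elim: (iota 0 n.+1) => [//|j s IH]; rewrite inE => /orP[/eqP->|/IH]; by [left|right].
have r0 : 0 < n.+1%:R^-1 :> R by rewrite invr_gt0.
have [|s [sD hs]] := @finite_net R W L [set u | S u /\ `|u| <= 1] _ r0.
  move=> k; rewrite /L; elim: (iota 0 n.+1) => [//|j s' IH] [<-|]; last exact: IH.
  have [_ [C hC]] := g_dense.1 j; exists `|C| => u [Su u1].
  apply: le_trans (hC u Su) _; apply: le_trans (ler_norm _) _.
  by rewrite normrM normr_id -[leRHS]mulr1 ler_wpM2l.
have [eta2 eta20 h2] : exists2 eta, 0 < eta & forall h, near w eta h ->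
    forall z, List.In z s -> `|h z - f z| < e / 9.
  have : forall z, List.In z s -> S z by move=> z /sD [].
  elim: s {sD hs} => [|z s IH] sS; first by exists 1.
  have [|et1 et10 H1] := IH; first by move=> u us; apply: sS; right.
  have [et2 et20 H2] := pt_small (sS z (or_introl erefl)) e9.
  exists (Num.min et1 et2); first by rewrite lt_min et10.
  move=> h hh u [<-|us].
    apply: (H2 w) => //; first by apply: near_mono hh; rewrite ge_min lexx orbT.
    by split=> //; rewrite (le_trans _ fmax) // gerBl ltW.
  by apply: H1 => //; apply: near_mono hh; rewrite ge_min lexx.
exists (Num.min eta1 eta2); first by rewrite lt_min eta10.
move=> h hh.
have hh1 : near w eta1 h by apply: near_mono hh; rewrite ge_min lexx.
have hh2 : near w eta2 h by apply: near_mono hh; rewrite ge_min lexx orbT.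
have nf : near w eta1 f by split=> //; rewrite (le_trans _ fmax) // gerBl ltW.
have Bh := KB hh.1.
have Th : T n h < 2 * (e / 9).
  by have := (h1 w h f Sw hh1 nf).1; rewrite ltr_norml; lra.
have ball u : S u -> `|u| <= 1 -> `|h u - f u| <= e.
  move=> Su u1; have [z zs hz] := hs u (conj Su u1); have [Sz z1] := sD z zs.
  have Suz := subspaceB Su Sz.
  have Av : A n (2^-1 *: (u - z)).
    split; first exact: subspaceZ.
      rewrite normrZ normfV gtr0_norm // mulrC ler_pdivrMr //.
      by apply: le_trans (ler_normB _ _) _; lra.
    move=> i /inL /hz H; have gl := (g_dense.1 i).1.
    rewrite (lin_onZ gl) // (lin_onB gl) // normrM normfV (@gtr0_norm _ 2) //.
    rewrite mulrC ler_pdivrMr //; apply: le_trans H _.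
    by rewrite ler_peMr ?ltW // ltr1n.
  have half k : B k -> `|k u - k z| <= 2 * T n k.
    move=> Bk; have := T_ub Bk Av; rewrite (lin_onZ Bk.1) // (lin_onB Bk.1) //.
    by rewrite normrM normfV (@gtr0_norm _ 2) // mulrC ler_pdivrMr // mulrC.
  have := half _ Bh; have := half _ Bf; have := h2 h hh2 z zs.
  rewrite ltr_norml !ler_norml; lra.
move=> u Su; have [->|u0] := eqVneq u 0.
  by rewrite (lin_on0 Bf.1) (lin_on0 Bh.1) subrr !normr0 mulr0.
have nu : 0 < `|u| by rewrite normr_gt0.
have := ball (`|u|^-1 *: u) (subspaceZ _ Su).
rewrite (lin_onZ Bf.1) // (lin_onZ Bh.1) // -mulrBr normrM normfV normr_id.
rewrite normrZ normfV normr_id mulVf ?gt_eqF // => /(_ (lexx _)).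
by rewrite mulrC ler_pdivrMr.
Qed.

(** The lower bound tests the supremum with [t * f], where f w = p w by Hahn-Banach, and the penalty
    is quadratic in [t]. For the last clause, a maximizer at w + h up to an error |h|^2 is a
    near-maximizer at [w], hence close to [f] in norm; an estimate from above is what a minimization
    requires. *)
Lemma smooth_sup : exists phi : W -> R,
  [/\ forall w, S w -> phi w <= p w,
      forall w t, S w -> 0 <= t <= 1 -> t * p w - kap * (2 * M ^+ 2) * t ^+ 2 <= phi w,
      forall w h, S w -> S h -> phi (w + h) <= phi w + M * `|h| &
      forall w, S w -> exists f, [/\ lin_on S f, forall u, S u -> f u <= p u,
        phi w <= f w & forall e, 0 < e -> exists2 del, 0 < del &
        forall h, S h -> `|h| < del -> phi (w + h) <= phi w + f h + e * `|h|]].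
Proof.
exists phi; split.
- exact: phi_p.
- move=> w t Sw /andP[t0 t1].
  have [|f [fl fp fw]] := @hahn_banach_cone R W p [set (w, - p w)] p_sub.
    move=> u s; suff H : cone_hull [set (w, - p w)] u s -> exists2 a, 0 <= a &
        u = a *: w /\ s = - (a * p w).
      move=> /H [a a0 [-> ->]]; by rewrite p_sub.2 // subrr.
    elim=> [|a h r v s' a0 [-> ->] _ [b b0 [-> ->]]].
      by exists 0 => //; rewrite scale0r mul0r oppr0.
    exists (a + b); first exact: addr_ge0.
    by rewrite scalerDl; split=> //; lra.
  have {}fw : p w <= f w by rewrite -[p w]opprK; exact: fw.
  have Kf : K f by split=> // a u v _ _; exact: fl.
  pose tf := fun u => t * f u.
  have Ktf : K tf.
    split=> [a u v Su Sv|u Su]; first by rewrite /tf fl /=; lra.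
    apply: (@le_trans _ _ (t * p u)); first by rewrite ler_wpM2l.
    by rewrite -[leRHS]mul1r ler_wpM2r.
  apply: le_trans (phi_ub Sw Ktf).
  have Qtf : Q tf <= t ^+ 2 * (2 * M ^+ 2).
    apply: Q_le => N; apply: le_trans (ler_wpM2l (sqr_ge0 t) (part_le N (KB Kf))).
    rewrite /part mulr_sumr; apply: ler_sum => n _.
    rewrite mulrCA ler_pM2l // mulrDr /tf exprMn lerD2r -exprMn.
    have Tt0 : 0 <= t * T n f by rewrite mulr_ge0 // T_ge0 //; exact: KB.
    rewrite ler_pXn2r ?nnegrE //; last by apply: T_ge0; exact: KB.
    apply: T_le => u Au; rewrite normrM ger0_norm // ler_wpM2l //.
    by apply: T_ub => //; exact: KB.
  have : kap * Q tf <= kap * (t ^+ 2 * (2 * M ^+ 2)) by rewrite ler_pM2l.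
  have : t * p w <= tf w by rewrite /tf ler_wpM2l.
  lra.
- move=> w h Sw Sh; apply: sup_image_le; first by exists (cst 0).
  move=> f Kf; rewrite (lin_onD Kf.1) //.
  have := phi_ub Sw Kf; have := (KB Kf).2 h Sh; rewrite ler_norml; lra.
- move=> w Sw; have [f Kf fmax] := exists_max Sw; exists f; split=> //.
  + exact: Kf.1.
  + exact: Kf.2.
  + by have := mulr_ge0 (ltW kap_gt0) (Q_ge0 (KB Kf)); lra.
  move=> e e0; have e2 : 0 < e / 2 by rewrite divr_gt0.
  have [eta eta0 heta] := norm_small Sw Kf fmax e2.
  have c0 : 0 < 2 * M + 1 by have := M_gt0; lra.
  exists (Num.min 1 (Num.min (e / 2) (eta / (2 * M + 1)))).
    by rewrite !lt_min ltr01 e2 divr_gt0.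
  move=> h Sh; rewrite !lt_min => /and3P[h1 he]; rewrite ltr_pdivlMr // => heta'.
  have [->|h0] := eqVneq h 0.
    by rewrite !addr0 (lin_on0 Kf.1) normr0 mulr0 !addr0.
  have nh : 0 < `|h| by rewrite normr_gt0.
  have [k [Kk hk]] := exists_near (subspaceD Sw Sh) (mulr_gt0 nh nh).
  have hM := (KB Kk).2 h Sh; have fM := (KB Kf).2 h Sh.
  rewrite (lin_onD Kk.1) // in hk.
  have hh : `|h| * `|h| <= `|h| by rewrite -[leRHS]mulr1 ler_pM2l // ltW.
  have hhe : `|h| * `|h| <= e / 2 * `|h| by rewrite ler_pM2r // ltW.
  have nk : near w eta k.
    split=> //; have := phi_ub (subspaceD Sw Sh) Kf; rewrite (lin_onD Kf.1) //.
    have := phi_ub Sw Kf; move: hM fM; rewrite !ler_norml; lra.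
  have := heta k nk h Sh; have := phi_ub Sw Kk; rewrite ler_norml; lra.
Qed.

End Subspace.
End SmoothSup.

(** * Fuzzy minimality in separable subspaces *)

Section FuzzySeparable.
Context {R : realType} {W : normedModType R}.
Implicit Types (S E : set W).

Local Notation dnorm := (fun x y : W => `|x - y|).

Lemma lipschitz_seq_lsc S E (f : W -> R) M : 0 < M ->
  linear_subspace S -> E `<=` S ->
  (forall w h, S w -> S h -> f (w + h) <= f w + M * `|h|) -> seq_lsc dnorm E f.
Proof.
move=> M0 Ssub ES fM u x Eu Ex ux e e0.
have [N hN] := ux _ (divr_gt0 e0 M0); exists N => n /hN.
rewrite ltr_pdivlMr // distrC mulrC => h.
have := fM (u n) (x - u n) (ES _ (Eu n)) (subspaceB Ssub (ES _ Ex) (ES _ (Eu n))).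
by rewrite addrC subrK; lra.
Qed.

Let pw (n : nat) : R := (2 ^+ n)^-1.

Let pw_gt0 n : 0 < pw n. Proof. by rewrite invr_gt0 exprn_gt0. Qed.

Let pwS n : pw n = 2 * pw n.+1.
Proof. by rewrite /pw exprS invfM mulrA divff ?mul1r. Qed.

Let pw_small e : 0 < e -> exists n, pw n < e.
Proof.
move=> /inv_natr_small [n hn]; exists n; apply: le_lt_trans hn.
rewrite lef_pV2 ?posrE ?exprn_gt0 ?ltr0n // -natrX ler_nat.
exact: ltn_expl.
Qed.

(* The linear minorants of p are regularized by smooth_sup, and the smooth
   variational principle restores an exact minimum on E. *)
Lemma fuzzy_minimum_separable S E (x : nat -> W) (g : nat -> W -> R)
    (p : W -> R) (M eps : R) (w0 : W) :
  linear_subspace S -> dense_seq S x -> dual_dense_seq S g ->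
  E `<=` S -> cauchy_complete dnorm E ->
  sublinear p -> (forall w, 0 <= p w) -> (forall w, p w <= M * `|w|) -> 0 < M ->
  E w0 -> (forall w, E w -> p w0 <= p w) -> 0 < eps ->
  exists (w : W) (f : W -> R),
    [/\ E w, `|w - w0| < eps & [/\ lin_on S f,
      forall u, S u -> f u <= p u + eps * `|u|, p w - eps <= f w &
      forall e : R, 0 < e -> exists2 del : R, 0 < del &
        forall w', E w' -> `|w' - w| < del -> - (e * `|w' - w|) <= f (w' - w)]].
Proof.
move=> Ssub xd gd ES Ecomp psub p0 pM M0 Ew0 pmin eps0.
have nsub : sublinear (fun w : W => `|w|).
  by split=> [u v|a u a0]; [exact: ler_normD | rewrite normrZ ger0_norm].
have k4 : 0 < 4^-1 :> R by rewrite invr_gt0.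
(* [Th] is a smooth gauge in place of the norm. With constants 1 and 1/4 its lower bound is t |w| -
   t^2 / 2, and t = min r 1 gives [s r <= Th w] whenever |w| >= r. *)
have [|Th [Th_le Th_ge Th_lip Th_diff]] :=
    smooth_sup Ssub xd gd nsub (fun w => normr_ge0 w) _ (@ltr01 R) k4.
  by move=> w; rewrite mul1r.
have Th0 w : S w -> 0 <= Th w.
  by move=> Sw; have := Th_ge w 0 Sw; rewrite lexx ler01 => /(_ isT); lra.
have Th00 : Th 0 = 0.
  apply/eqP; rewrite eq_le Th0 ?andbT //; last exact: Ssub.1.
  by have := Th_le 0 Ssub.1; rewrite normr0.
pose s (r : R) := (Num.min r 1) ^+ 2 / 2.
have s_gt0 r : 0 < r -> 0 < s r.
  by move=> r0; rewrite divr_gt0 // exprn_gt0 // lt_min r0 ltr01.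
have s_le r : 0 < r -> s r <= 2^-1.
  move=> r0; rewrite /s ler_pdivrMr // mulVf // exprn_ile1 //.
    by rewrite le_min ltW //= ler01.
  by rewrite ge_min lexx orbT.
have Th_s r w : 0 < r -> S w -> Th w < s r -> `|w| < r.
  move=> r0 Sw; rewrite ltNge => h; rewrite ltNge; apply: contra h => rw.
  have m1 : Num.min r 1 <= 1 by rewrite ge_min lexx orbT.
  have mr : Num.min r 1 <= r by rewrite ge_min lexx.
  have m0 : 0 <= Num.min r 1 by rewrite le_min ltW //= ler01.
  have := Th_ge w (Num.min r 1) Sw; rewrite m0 m1 => /(_ isT).
  have : Num.min r 1 * Num.min r 1 <= Num.min r 1 * `|w|.
    by apply: ler_wpM2l => //; apply: le_trans mr rw.
  rewrite /s; move: (Num.min r 1) (Th w) `|w| => a b c; nra.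
(* [mu] will bound the dual norm of the total perturbation [L], which then costs less than eps / 2
   at points of norm at most |w0| + eps. *)
pose mu := eps / 2 / (1 + `|w0| + eps).
have den : 0 < 1 + `|w0| + eps by have := normr_ge0 w0; lra.
have mu0 : 0 < mu by rewrite !divr_gt0.
have muE : mu * (1 + `|w0| + eps) = eps / 2 by rewrite /mu divfK // gt_eqF.
have mu_half : mu <= 2^-1.
  rewrite /mu ler_pdivrMr //; have := normr_ge0 w0; lra.
have mu_eps : mu <= eps / 2.
  rewrite -muE -[leLHS]mulr1 ler_pM2l //; have := normr_ge0 w0; lra.
pose m i := mu * pw i.+1.
have m0 i : 0 < m i by rewrite mulr_gt0.
(* Replacing [p] by [ph] costs at most [gam]. As [w0] minimizes [p], the first penalty term at [w]
   is then below [m 0 * s eps], which keeps [w] within [eps] of [w0]. *)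
pose gam := m 0%N * s eps / 2.
have gam0 : 0 < gam by rewrite divr_gt0 // mulr_gt0 // s_gt0.
have gam_eps : gam <= mu.
  have h1 : m 0%N <= mu.
    rewrite /m -[leRHS]mulr1 ler_pM2l // /pw expr1 invf_le1 //; lra.
  have h2 := s_le eps eps0.
  have : m 0%N * s eps <= mu * 2^-1.
    by apply: ler_pM => //; rewrite ltW // s_gt0.
  rewrite /gam; lra.
have MM : 0 < 2 * M ^+ 2 by rewrite mulr_gt0 // exprn_gt0.
have [ph [ph_le ph_ge ph_lip ph_diff]] :=
  smooth_sup Ssub xd gd psub p0 pM M0 (divr_gt0 gam0 MM).
have ph_p w : S w -> p w - gam <= ph w.
  move=> Sw; have := ph_ge w 1 Sw; rewrite ler01 lexx divfK ?gt_eqF // => /(_ isT).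
  by rewrite expr1n mulr1 mul1r.
have dtri (a b c : W) : `|b - c| <= `|b - a| + `|a - c|.
  by rewrite -[b - c](subrKA a) ler_normD.
have [||||||||||w [a [Ew Ea w_w0 wmin]]] := @variational_principle R W dnorm
  _ (fun a b c => dtri a b c) _ E ph (fun w a => Th (w - a)) m w0 Ecomp.
- by move=> u v; rewrite distrC.
- by move=> u v; rewrite normr_le0 subr_eq0 => /eqP.
- exact: (lipschitz_seq_lsc M0 Ssub ES ph_lip).
- move=> b Eb; apply: (lipschitz_seq_lsc ltr01 Ssub ES) => u h Su Sh.
  by rewrite addrAC; apply: Th_lip => //; apply: subspaceB => //; apply: ES.
- by move=> u b Eu Eb; apply: Th0; apply: subspaceB => //; apply: ES.
- by move=> b Eb; rewrite subrr.
- move=> r r0; exists (s r); first exact: s_gt0.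
  by move=> u b Eu Eb; apply: Th_s => //; apply: subspaceB => //; apply: ES.
- exact: m0.
- exists (- gam) => u Eu; have := ph_p u (ES _ Eu); have := p0 u; lra.
- exact: Ew0.
have Sw := ES _ Ew; have Sw0 := ES _ Ew0.
have w_near : `|w - w0| < eps.
  apply: Th_s => //; first exact: subspaceB.
  rewrite -(ltr_pM2l (m0 0%N)).
  have := ph_p w Sw; have := pmin w Ew; have := ph_le w0 Sw0.
  have : 0 < m 0%N * s eps by rewrite mulr_gt0 // s_gt0.
  rewrite /gam in gam0 *; lra.
(* [G i] is a derivative from above of the i-th penalty at [w], of norm at most 1. The multiplier
   will be [f] plus the sum [L] of the [m i * G i]. *)
have /choice [G hG] : forall i, exists k, [/\ lin_on S k,
    forall u, S u -> `|k u| <= `|u| & forall e : R, 0 < e -> exists2 del : R, 0 < del &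
        forall h, S h -> `|h| < del ->
        Th (w + h - a i) <= Th (w - a i) + k h + e * `|h|].
  move=> i; have Swa := subspaceB Ssub Sw (ES _ (Ea i)).
  have [k [kl k1 _ kd]] := Th_diff _ Swa; exists k; split=> //.
    move=> u Su; have := @lin_on_le_norm _ _ _ Ssub _ kl _ 1 _ k1 u Su.
    by rewrite mul1r; apply=> v; rewrite mul1r.
  move=> e e0; have [del del0 hd] := kd e e0; exists del => // h Sh hdel.
  by rewrite addrAC; exact: hd.
pose P n u := \sum_(i < n) m i * G i u.
have Ptail n k u : S u -> `|P (n + k)%N u - P n u| <= mu * (pw n - pw (n + k)) * `|u|.
  move=> Su; elim: k => [|k IH]; first by rewrite addn0 !subrr normr0 mulr0 mul0r.
  rewrite addnS /P big_ord_recr /= -/(P _ u) addrAC.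
  apply: le_trans (ler_normD _ _) _; have [_ /(_ u Su) h _] := hG (n + k)%N.
  rewrite normrM (gtr0_norm (m0 _)).
  have : m (n + k)%N * `|G (n + k)%N u| <= m (n + k)%N * `|u| by rewrite ler_pM2l.
  rewrite /m; have := pwS (n + k); nra.
have tail_le n k u : S u -> `|P (n + k)%N u - P n u| <= mu * pw n * `|u|.
  move=> /(Ptail n k) h; apply: le_trans h _; rewrite ler_wpM2r // ler_pM2l //.
  by rewrite gerBl ltW.
have lim u : exists l, S u -> converges (fun x y => `|x - y|) (P ^~ u) l.
  have [Su|nSu] := pselect (S u); last by exists 0.
  have [|l hl] := @cauchy_real_converges R (P ^~ u); last by exists l.
  move=> e e0; have c0 : 0 < 2 * (mu * (1 + `|u|)).
    by rewrite mulr_gt0 // mulr_gt0 // ltr_pwDl.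
  have [N hN] := pw_small (divr_gt0 e0 c0).
  have hN' : 2 * (mu * pw N * `|u|) < e.
    move: hN; rewrite ltr_pdivlMr // => hN.
    have : 0 < mu * pw N by rewrite mulr_gt0.
    by nra.
  exists N => i j /subnKC <- /subnKC <-.
  have := tail_le N (i - N)%N u Su; have := tail_le N (j - N)%N u Su.
  by rewrite !ler_norml ltr_norml; lra.
have /choice [L hL] := lim.
have Pl n : lin_on S (P n).
  move=> b u v Su Sv; rewrite /P mulr_sumr -big_split /=; apply: eq_bigr => i _.
  by have [kl _ _] := hG i; rewrite kl //; ring.
have Ll : lin_on S L := lin_on_limit Ssub Pl hL.
have Ltail n u : S u -> `|L u - P n u| <= mu * pw n * `|u|.
  move=> Su; apply/ler_addgt0Pl => e e0; have [N hN] := hL u Su e e0.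
  have := hN _ (leq_addl n N); have := tail_le n N u Su.
  by rewrite !ler_norml ltr_norml; lra.
have L_le u : S u -> `|L u| <= mu * `|u|.
  move=> /(Ltail 0%N); rewrite /P big_ord0 subr0 /pw expr0 invr1 mulr1; exact.
have [f [fl fp fw fd]] := ph_diff w Sw.
exists w, (fun u => f u + L u); split=> //; split.
- by move=> b u v Su Sv; rewrite fl // Ll //; ring.
- move=> u Su; have := fp u Su; have := L_le u Su.
  have : mu * `|u| <= eps / 2 * `|u| by rewrite ler_wpM2r.
  have := normr_ge0 u.
  have : eps / 2 * `|u| <= eps * `|u| by rewrite ler_wpM2r // ler_pdivrMr //; lra.
  by rewrite ler_norml; lra.
- have := L_le w Sw; have := ph_p w Sw.
  have wle : `|w| <= `|w0| + eps.
    by rewrite -[w in `|w|](subrK w0) addrC (le_trans (ler_normD _ _)) // lerD2l ltW.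
  have : mu * `|w| <= mu * (`|w0| + eps) by rewrite ler_pM2l.
  move: muE; rewrite !mulrDr mulr1 ler_norml; lra.
(* Four errors of size e / 4: the derivative of [ph], the derivatives of the first [n] penalties,
   the remaining penalties through their Lipschitz bound, and the tail of [L]. *)
move=> e e0; have e4 : 0 < e / 4 by rewrite divr_gt0.
have [n hn] := pw_small e4.
have [del1 del10 hd1] := fd _ e4.
have [del2 del20 hd2] : exists2 del : R, 0 < del & forall i, (i < n)%N ->
    forall h, S h -> `|h| < del ->
    Th (w + h - a i) <= Th (w - a i) + G i h + (e / 4) * `|h|.
  elim: n {hn} => [|n [dl dl0 IH]]; first by exists 1.
  have [_ _ /(_ _ e4) [dl' dl'0 H]] := hG n.
  exists (Num.min dl dl'); first by rewrite lt_min dl0.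
  move=> i; rewrite ltnS leq_eqVlt => /orP[/eqP->|ilt] h Sh; rewrite lt_min => /andP[h1 h2].
    exact: H.
  exact: IH.
exists (Num.min del1 del2); first by rewrite lt_min del10.
move=> w' Ew'; rewrite lt_min => /andP[h1 h2].
have Sh := subspaceB Ssub (ES _ Ew') Sw.
have := wmin w' Ew'; set h := w' - w in h1 h2 Sh *.
have -> : w' = w + h by rewrite addrC subrK.
move=> [i0 hmin].
pose D i := Th (w + h - a i) - Th (w - a i).
have D_le i : D i <= `|h|.
  have := Th_lip (w - a i) h (subspaceB Ssub Sw (ES _ (Ea i))) Sh.
  by rewrite addrAC mul1r /D; lra.
have head k : (k <= n)%N -> \sum_(i < k) m i * D i <=
    P k h + mu * (1 - pw k) * (e / 4 * `|h|).
  elim: k => [|k IH] kn.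
    by rewrite /P !big_ord0 /pw expr0 invr1 subrr mulr0 mul0r addr0.
  rewrite /P !big_ord_recr /= -/(P k h).
  have := IH (ltnW kn).
  have : m k * D k <= m k * (G k h + e / 4 * `|h|).
    by rewrite ler_pM2l // /D; have := hd2 k kn h Sh h2; lra.
  rewrite /m; have := pwS k; move: (e / 4 * `|h|) => c.
  move: (\sum_(i < k) _) (P k h) (G k h) (D k) (pw k) (pw k.+1) => x1 x2 x3 x4 x5 x6.
  by move=> ->; nra.
have all k : \sum_(i < n + k) m i * D i <=
    P n h + mu * (1 - pw n) * (e / 4 * `|h|) + mu * (pw n - pw (n + k)%N) * `|h|.
  elim: k => [|k IH]; first by rewrite addn0 subrr mulr0 mul0r addr0; exact: head.
  rewrite addnS big_ord_recr /=.
  have : m (n + k)%N * D (n + k)%N <= m (n + k)%N * `|h| by rewrite ler_pM2l.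
  move: IH; rewrite {2}/m /m; have := pwS (n + k).
  move: (\sum_(i < n + k) _) (P n h) (D (n + k)%N) (pw n) (pw (n + k)) (pw (n + k).+1).
  by move=> x1 x2 x3 x4 x5 x6 ->; nra.
have := hmin _ (leq_addl n i0).
have Dsum : \sum_(i < n + i0) m i * D i = \sum_(j < n + i0) m j * Th (w + h - a j) -
    \sum_(j < n + i0) m j * Th (w - a j).
  by rewrite -sumrB; apply: eq_bigr => i _; rewrite mulrBr.
have := all i0; rewrite Dsum.
have := hd1 h Sh h1; have := Ltail n h Sh.
have nh := normr_ge0 h.
have b1 : mu * pw n * `|h| <= e / 4 * `|h|.
  rewrite ler_wpM2r // -[leRHS]mul1r; apply: ler_pM => //; [exact: ltW..| |exact: ltW].
  lra.
have b2 : mu * (1 - pw n) * (e / 4 * `|h|) <= e / 4 * `|h|.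
  rewrite -[leRHS]mul1r ler_wpM2r //; first by rewrite mulr_ge0 // ltW.
  have := pw_gt0 n; nra.
have b3 : mu * (pw n - pw (n + i0)) * `|h| <= mu * pw n * `|h|.
  by rewrite ler_wpM2r // ler_pM2l // gerBl ltW.
rewrite ler_norml; lra.
Qed.

End FuzzySeparable.

(** * Separable reduction *)

Section CountableClosure.
Variables (A : Type) (I : countType) (op : I -> A -> A -> A) (a0 : A).

Fixpoint tree_eval (t : GenTree.tree I) : A :=
  if t is GenTree.Node _ [:: GenTree.Leaf i; t1; t2]
  then op i (tree_eval t1) (tree_eval t2) else a0.

(** The sequence lists the values of all terms built from [a0] by the operations. Terms are trees
    over a countable type and are enumerated by decoding; a code that is not a term yields [a0]. *)
Lemma countable_closure : exists c : nat -> A,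
  (exists n, c n = a0) /\ forall i m n, exists k, c k = op i (c m) (c n).
Proof.
pose dec n := odflt (GenTree.Node 0 [::]) (@choice.unpickle (GenTree.tree I) n).
exists (fun n => tree_eval (dec n)); split.
  by exists (choice.pickle (GenTree.Node 0 [::] : GenTree.tree I)); rewrite /dec choice.pickleK.
move=> i m n.
exists (choice.pickle (GenTree.Node 0 [:: GenTree.Leaf i; dec m; dec n])).
by rewrite {1}/dec choice.pickleK.
Qed.

End CountableClosure.

Section SeparableReduction.
Context {R : realType} {W : normedModType R}.
Implicit Types (S E : set W).

Local Notation dnorm := (fun x y : W => `|x - y|).

(** The Asplund property in sequential form. This is the form that is carried over to product
    spaces. *)
Definition separable_duals :=
  forall S, linear_subspace S -> (exists x, dense_seq S x) ->
  exists g, dual_dense_seq S g.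

Definition seq_closure (c : nat -> W) : set W :=
  [set w | forall e : R, 0 < e -> exists n, `|w - c n| < e].

Lemma seq_closure_mem c n : seq_closure c (c n).
Proof. by move=> e e0; exists n; rewrite subrr normr0. Qed.

Lemma seq_closure_subspace c :
  (forall (q : rat) m n, exists k, c k = ratr q *: c m + c n) ->
  linear_subspace (seq_closure c).
Proof.
move=> hc; split.
  move=> e e0; have [k hk] := hc (-1) 0%N 0%N; exists k.
  by rewrite hk rmorphN1 scaleN1r addNr subrr normr0.
move=> a x y Sx Sy e e0.
have x1 : 0 < 3 * (`|x| + 1) by rewrite mulr_gt0 // ltr_wpDl.
have a1 : 0 < 3 * (`|a| + 1) by rewrite mulr_gt0 // ltr_wpDl.
have e3 : 0 < e / 3 by rewrite divr_gt0.
(* The second entry controls the error in the scalar [a]; the first gives |q| <= |a| + 1, which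
   controls the error in [x]. *)
pose r := Num.min 1 (e / (3 * (`|x| + 1))).
have r0 : 0 < r by rewrite lt_min ltr01 divr_gt0.
have ar : a - r < a + r by lra.
have [q] := rat_in_itvoo ar.
rewrite in_itv /= => hq.
have [m hm] := Sx _ (divr_gt0 e0 a1); have [n hn] := Sy _ e3.
have [k hk] := hc q m n; exists k; rewrite hk.
have aq : `|a - ratr q| < r by rewrite ltr_norml; lra.
have -> : a *: x + y - (ratr q *: c m + c n) =
    (a - ratr q) *: x + ratr q *: (x - c m) + (y - c n).
  by rewrite scalerBl scalerBr subrKA opprD addrACA.
apply: le_lt_trans (ler_normD _ _) _.
have h1 := ler_normD ((a - ratr q) *: x) (ratr q *: (x - c m)).
rewrite (normrZ (a - ratr q)) (normrZ (ratr q)) in h1.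
have h2 : `|a - ratr q| * `|x| <= e / (3 * (`|x| + 1)) * `|x|.
  by rewrite ler_wpM2r // (le_trans (ltW aq)) // ge_min lexx orbT.
have h3 : e / (3 * (`|x| + 1)) * `|x| <= e / 3.
  have -> : e / 3 = e / (3 * (`|x| + 1)) * (`|x| + 1).
    have : `|x| + 1 != 0 by rewrite gt_eqF // ltr_wpDl.
    by move=> ?; field.
  by rewrite ler_pM2l ?divr_gt0 // lerDl.
have hqa : `|ratr q : R| <= `|a| + 1.
  have : r <= 1 by rewrite ge_min lexx.
  by have := ler_normB a (a - ratr q); rewrite subKr; lra.
have h4 : `|ratr q| * `|x - c m| <= (`|a| + 1) * (e / (3 * (`|a| + 1))).
  by apply: ler_pM => //; exact: ltW.
have h5 : (`|a| + 1) * (e / (3 * (`|a| + 1))) = e / 3.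
  have : `|a| + 1 != 0 by rewrite gt_eqF // ltr_wpDl.
  by move=> ?; field.
lra.
Qed.

(* Weighted points (a, w', j): multiples of the constraint
   [f (w' - w) >= - `|w' - w| / j.+1]. *)
Let item := (R * W * nat)%type.
Let X (w : W) (l : seq item) := \sum_(i <- l) i.1.1 *: (i.1.2 - w).
Let Y (w : W) (l : seq item) := \sum_(i <- l) i.1.1 * (`|i.1.2 - w| / i.2.+1%:R).
Let A (l : seq item) := \sum_(i <- l) i.1.1.

Variables (E : set W) (p : W -> R) (M eps : R).
Hypotheses (psub : sublinear p) (p0 : forall w, 0 <= p w)
  (pM : forall w, p w <= M * `|w|) (M0 : 0 < M) (eps0 : 0 < eps).

Let q u := p u + eps * `|u|.
(** The quantity tested by Hahn-Banach at the cone element coded by [l] and by the weight [t] of the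
    constraint p w - eps <= f w. A negative value is an obstruction. *)
Let val w l t := q (X w l + t *: w) + Y w l - t * (p w - eps).
(** Lipschitz constant of [val] in the base point, per unit of weight: M + eps from [q], 1 from [Y],
    M from [p]. *)
Let lipc := 2 * M + eps + 1.

(** [k] is a modulus that assigns to the tolerance 1 / (j + 1) the radius 1 / (k j + 1). Once it is
    fixed, the first-order condition is a family of linear inequalities. *)
Let constraints (w : W) (k : nat -> nat) : set (W * R) :=
  [set h | h = (w, - (p w - eps)) \/ exists j w',
     [/\ E w', `|w' - w| < (k j).+1%:R^-1 & h = (w' - w, `|w' - w| / j.+1%:R)]].

Let nonneg (l : seq item) := forall i, List.In i l -> 0 <= i.1.1.

Let qsub : sublinear q.
Proof.
split=> [u v|a u a0]; rewrite /q.
  have := psub.1 u v.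
  have : eps * `|u + v| <= eps * (`|u| + `|v|) by rewrite ler_pM2l // ler_normD.
  lra.
by rewrite psub.2 // normrZ ger0_norm //; lra.
Qed.

Let cone_hull_list w k x s : cone_hull (constraints w k) x s ->
  exists (l : seq item) t, [/\ 0 <= t, nonneg l,
    forall i, List.In i l -> E i.1.2 /\ `|i.1.2 - w| < (k i.2).+1%:R^-1,
    x = X w l + t *: w & s = Y w l - t * (p w - eps)].
Proof.
elim=> [|a h r x' s' a0 Ch _ [l [t [t0 l0 lE -> ->]]]].
  exists [::], 0; split=> //; first by rewrite /X big_nil scale0r addr0.
  by rewrite /Y big_nil mul0r subr0.
case: Ch => [[-> ->]|[j [w' [Ew' hw' [-> ->]]]]].
  exists l, (a + t); split=> //; first exact: addr_ge0.
    by rewrite scalerDl addrCA.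
  by lra.
exists ((a, w', j) :: l), t; split=> //.
- by move=> i [<-//|]; exact: l0.
- by move=> i [<-//|]; exact: lE.
- by rewrite /X big_cons /= addrA.
- by rewrite /Y big_cons /= addrA.
Qed.

Let A_ge0 l : nonneg l -> 0 <= A l.
Proof.
rewrite /A; elim: l => [|i l IH] l0; first by rewrite big_nil.
rewrite big_cons addr_ge0 //; first by apply: l0; left.
by apply: IH => j jl; apply: l0; right.
Qed.

Let X_diff w d l : X w l - X d l = - A l *: (w - d).
Proof.
rewrite /X /A -sumrB -sumrN scaler_suml; apply: eq_bigr => i _.
by rewrite -scalerBr scaleNr -scalerN opprB; congr (_ *: _); rewrite opprB addrC addrA subrK.
Qed.

Let Y_diff w d l : nonneg l -> Y w l <= Y d l + A l * `|w - d|.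
Proof.
rewrite /Y /A; elim: l => [|i l IH] l0; first by rewrite !big_nil mul0r addr0.
rewrite !big_cons.
have i0 : 0 <= i.1.1 by apply: l0; left.
have := IH (fun j jl => l0 j (or_intror jl)).
have : `|i.1.2 - w| / i.2.+1%:R <= `|i.1.2 - d| / i.2.+1%:R + `|w - d|.
  have h : `|w - d| / i.2.+1%:R <= `|w - d|.
    by rewrite ler_pdivrMr // ler_peMr // ler1n.
  have : `|i.1.2 - w| / i.2.+1%:R <= (`|i.1.2 - d| + `|w - d|) / i.2.+1%:R.
    rewrite ler_pM2r ?invr_gt0 // -[i.1.2 - w](subrKA d) (distrC w).
    exact: ler_normD.
  by move=> /le_trans; apply; rewrite mulrDl lerD2l.
move: (_ / _) (_ / _) => a b; move=> /(ler_wpM2l i0); lra.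
Qed.

Let val_diff w d l t : nonneg l -> 0 <= t ->
  val w l t <= val d l t + lipc * (A l + t) * `|w - d|.
Proof.
move=> l0 t0; have := Y_diff w d l0; have Al := A_ge0 l0.
have h1 : q (X w l + t *: w) - q (X d l + t *: d) <= (M + eps) * ((A l + t) * `|w - d|).
  apply: le_trans (sublinearB _ _ qsub) _.
  have -> : X w l + t *: w - (X d l + t *: d) = (t - A l) *: (w - d).
    rewrite opprD addrACA X_diff -scalerBr -scalerDl; congr (_ *: _); lra.
  have h : `|(t - A l) *: (w - d)| <= (A l + t) * `|w - d|.
    by rewrite normrZ ler_wpM2r // ler_norml; lra.
  have := pM ((t - A l) *: (w - d)).
  have : (M + eps) * `|(t - A l) *: (w - d)| <= (M + eps) * ((A l + t) * `|w - d|).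
    by rewrite ler_wpM2l //; have := M0; have := eps0; lra.
  by rewrite /q; lra.
have h2 : p d - p w <= M * `|w - d|.
  by apply: le_trans (sublinearB _ _ psub) _; rewrite distrC.
have h3 := ler_wpM2l t0 h2.
have h4 : 0 <= A l * `|w - d| by rewrite mulr_ge0.
have h5 : 0 <= t * `|w - d| by rewrite mulr_ge0.
have h6 := mulr_ge0 (ltW M0) h4.
rewrite /val /lipc; move: h1 h3; move: (q _) (q _) => q1 q2 h1 h3; lra.
Qed.

(** An obstruction with a margin: it remains one at every point within 1 / (n + 1) of [d]. Only a
    finite part [ks] of the modulus is recorded, so that for each [d] the parameters are
    countable. *)
Let fails (ks : seq nat) (n : nat) (d : W) (l : seq item) (t : R) :=
  [/\ 0 <= t, nonneg l,
    forall i, List.In i l -> [/\ E i.1.2, (i.2 < size ks)%N &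
      `|i.1.2 - d| + n.+1%:R^-1 < (nth 0%N ks i.2).+1%:R^-1] &
    val d l t + lipc * n.+1%:R^-1 * (A l + t) < 0].

(* If every candidate of E admits no functional, Hahn-Banach produces for each
   candidate a finite obstruction; a separable subspace closed under the choice
   of obstructions contradicts fuzzy_minimum_separable. *)
Theorem fuzzy_minimum (w0 : W) :
  separable_duals -> cauchy_complete dnorm E ->
  E w0 -> (forall w, E w -> p w0 <= p w) ->
  exists (w : W) (f : W -> R),
    [/\ E w, `|w - w0| < eps & [/\ scalar f,
      forall u, f u <= p u + eps * `|u|, p w - eps <= f w &
      forall e : R, 0 < e -> exists2 del : R, 0 < del &
        forall w', E w' -> `|w' - w| < del -> - (e * `|w' - w|) <= f (w' - w)]].
Proof.
move=> Wasp Ecomp Ew0 pmin; apply: contrapT => noex.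
have lipc0 : 0 < lipc by rewrite /lipc; have := M0; have := eps0; lra.
have obstruction w (k : nat -> nat) : E w -> `|w - w0| < eps ->
    exists (l : seq item) t, [/\ 0 <= t, nonneg l,
    forall i, List.In i l -> E i.1.2 /\ `|i.1.2 - w| < (k i.2).+1%:R^-1 &
    val w l t < 0].
  move=> Ew ww0; apply: contrapT => noobs; apply: noex.
  have [|f [fl fq fc]] := @hahn_banach_cone R W q (constraints w k) qsub.
    move=> x s /cone_hull_list [l [t [t0 l0 lE -> ->]]].
    rewrite leNgt; apply/negP => neg; apply: noobs.
    by exists l, t; split=> //; rewrite /val -addrA.
  exists w, f; split=> //; split=> //.
    by rewrite -[p w - eps]opprK; apply: fc; left.
  move=> e /inv_natr_small [j je]; exists (k j).+1%:R^-1; first by rewrite invr_gt0.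
  move=> w' Ew' hw'.
  have : - (`|w' - w| / j.+1%:R) <= f (w' - w).
    by apply: fc; right; exists j, w'.
  apply: le_trans; rewrite lerN2 mulrC ler_wpM2r //; exact: ltW.
have /choice [ch hch] : forall x : seq nat * nat * W, exists y : seq item * R,
    (exists l t, fails x.1.1 x.1.2 x.2 l t) -> fails x.1.1 x.1.2 x.2 y.1 y.2.
  move=> [[ks n] d] /=.
  have [[l [t h]]|nh] := pselect (exists l t, fails ks n d l t); last by exists ([::], 0).
  by exists (l, t).
(* [inl] yields rational combinations, [inr] the j-th point of the obstruction chosen at [u]. *)
pose op (i : rat + seq nat * nat * nat) (u v : W) : W :=
  match i with
  | inl r => ratr r *: u + v
  | inr (ks, n, j) => (nth (0, w0, 0%N) (ch (ks, n, u)).1 j).1.2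
  end.
have [c [[n0 cn0] cop]] := countable_closure op w0.
pose S := seq_closure c.
have Ssub : linear_subspace S.
  by apply: seq_closure_subspace => r m n; exact: (cop (inl r) m n).
have Sdense : dense_seq S c by split=> [n|w Sw]; [exact: seq_closure_mem | exact: Sw].
have [g gd] := Wasp S Ssub (ex_intro _ c Sdense).
have ES : E `&` S `<=` S by move=> w [].
have EScomp : cauchy_complete dnorm (E `&` S).
  move=> u ESu uC; have [x Ex ux] := Ecomp u (fun n => (ESu n).1) uC.
  exists x => //; split=> // e e0; have e2 : 0 < e / 2 by rewrite divr_gt0.
  have [N /(_ N (leqnn _)) hN] := ux _ e2; have [m hm] := (ESu N).2 _ e2.
  exists m; rewrite -[x - _](subrKA (u N)); apply: le_lt_trans (ler_normD _ _) _.
  by rewrite distrC; lra.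
have ESw0 : (E `&` S) w0 by split=> //; rewrite -cn0; exact: seq_closure_mem.
have [w [f [[Ew Sw] ww0 [fl fq fw fd]]]] :=
  fuzzy_minimum_separable Ssub Sdense gd ES EScomp psub p0 pM M0 ESw0
    (fun w h => pmin w h.1) eps0.
have /choice [k hk] : forall j : nat, exists k : nat, forall w', (E `&` S) w' ->
    `|w' - w| < k.+1%:R^-1 -> - (`|w' - w| / j.+1%:R) <= f (w' - w).
  move=> j; have j0 : 0 < j.+1%:R^-1 :> R by rewrite invr_gt0.
  have [del del0 hdel] := fd _ j0; have [k hk] := inv_natr_small del0.
  exists k => w' Ew' hw'; rewrite mulrC; apply: hdel => //; exact: lt_trans hk.
have [l [t [t0 l0 lE lval]]] := obstruction w k Ew ww0.
(* Twice the margin 1 / (n + 1): one part is spent on moving the base point from [w] to [d], the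
   other is demanded by [fails]. *)
have [n hn hval] : exists2 n, forall i, List.In i l ->
      `|i.1.2 - w| + 2 * n.+1%:R^-1 < (k i.2).+1%:R^-1 &
    val w l t + 2 * (lipc * n.+1%:R^-1 * (A l + t)) < 0.
  have [n1 h1] : exists n1 : nat, forall i, List.In i l ->
      `|i.1.2 - w| + 2 * n1.+1%:R^-1 < (k i.2).+1%:R^-1.
    elim: l lE {l0 lval} => [|i l IH] lE; first by exists 0%N.
    have [|n1 h1] := IH; first by move=> j jl; apply: lE; right.
    have [_ hi] := lE i (or_introl erefl).
    have gap0 : 0 < ((k i.2).+1%:R^-1 - `|i.1.2 - w|) / 2 by rewrite divr_gt0 // subr_gt0.
    have [n2 h2] := inv_natr_small gap0.
    exists (maxn n1 n2) => j [<-|jl].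
      have := @inv_natr_le R _ _ (leq_maxr n1 n2).
      move: h2; rewrite ltr_pdivlMr //.
      by move: (_^-1) (_^-1) (_^-1) => r1 r2 r3; lra.
    have := @inv_natr_le R _ _ (leq_maxl n1 n2); have := h1 j jl.
    by move: (_^-1) (_^-1) (_^-1) => r1 r2 r3; lra.
  have At : 0 < 2 * (lipc * (A l + t + 1)).
    by rewrite mulr_gt0 // mulr_gt0 // ltr_wpDl // addr_ge0 // A_ge0.
  have lval' : 0 < - val w l t by rewrite oppr_gt0.
  have [n2 h2] := inv_natr_small (divr_gt0 lval' At).
  exists (maxn n1 n2).
    move=> i il; have := @inv_natr_le R _ _ (leq_maxl n1 n2); have := h1 i il.
    by move: (_^-1) (_^-1) (_^-1) => r1 r2 r3; lra.
  move: h2; rewrite ltr_pdivlMr // => h2.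
  have r2 := @inv_natr_le R _ _ (leq_maxr n1 n2).
  have := ler_wpM2r (ltW At) r2.
  have r0 : 0 < (maxn n1 n2).+1%:R^-1 :> R by rewrite invr_gt0.
  have := mulr_gt0 lipc0 r0; move: h2; move: (_^-1) (_^-1) => r1 r2'; lra.
set r : R := n.+1%:R^-1 in hn hval.
have r0 : 0 < r by rewrite invr_gt0.
have [m hm] := Sw r r0; set d := c m in hm.
pose N := (\max_(i <- l) i.2.+1)%N.
have N_l i : List.In i l -> (i.2 < N)%N.
  rewrite /N; elim: (l) => [//|j l' IH]; rewrite big_cons leq_max => -[->|/IH ->].
    by rewrite leqnn.
  by rewrite orbT.
pose ks := mkseq k N.
have : exists l t, fails ks n d l t.
  exists l, t; split=> //.
    move=> i il; have [Ei _] := lE i il; split=> //; first by rewrite size_mkseq N_l.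
    rewrite nth_mkseq ?N_l // -/r; have := hn i il.
    have : `|i.1.2 - d| <= `|i.1.2 - w| + `|w - d|.
      by rewrite -[i.1.2 - d](subrKA w) ler_normD.
    by move: hm; move: (_^-1) => r1; clearbody r; lra.
  have := val_diff d w l0 t0; rewrite -/r (distrC d).
  have : lipc * (A l + t) * `|w - d| <= lipc * (A l + t) * r.
    apply: ler_wpM2l (ltW hm).
    exact: mulr_ge0 (ltW lipc0) (addr_ge0 (A_ge0 l0) t0).
  lra.
(* Unlike [l], the chosen obstruction [l'] has its points in [S], where [f] satisfies its
   constraints. Evaluating [f] makes [val w l' t'] nonnegative, against the margin. *)
move=> /(hch (ks, n, d)) /=; set l' := (ch _).1; set t' := (ch _).2.
move=> [t'0 l'0 l'E l'val].
have l'S i : List.In i l' -> S i.1.2.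
  move=> il; have [j <-] : exists j, nth (0, w0, 0%N) l' j = i.
    elim: (l') il => [//|a s IH] [->|/IH [j hj]]; [by exists 0%N | by exists j.+1].
  have [z hz] := cop (inr (ks, n, j)) m 0%N.
  have -> : (nth (0, w0, 0%N) l' j).1.2 = c z by rewrite hz.
  exact: seq_closure_mem.
have l'f i : List.In i l' -> - (`|i.1.2 - w| / i.2.+1%:R) <= f (i.1.2 - w).
  move=> il; have [Ei iN hi] := l'E i il; apply: hk; first by split=> //; exact: l'S.
  rewrite size_mkseq in iN; move: hi; rewrite nth_mkseq // -/r.
  have : `|i.1.2 - w| <= `|i.1.2 - d| + `|w - d|.
    by rewrite (distrC w) -[i.1.2 - w](subrKA d) ler_normD.
  by move: hm; move: (_^-1) => r1; clearbody r; lra.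
have XS s : (forall i, List.In i s -> S i.1.2) -> S (X w s).
  rewrite /X; elim: s => [|i s IH] sS; first by rewrite big_nil; exact: Ssub.1.
  rewrite big_cons; apply: (subspaceD Ssub).
    by apply/(subspaceZ Ssub)/(subspaceB Ssub) => //; apply: sS; left.
  by apply: IH => j js; apply: sS; right.
have fX s : (forall i, List.In i s -> S i.1.2) -> nonneg s ->
    (forall i, List.In i s -> - (`|i.1.2 - w| / i.2.+1%:R) <= f (i.1.2 - w)) ->
    - Y w s <= f (X w s).
  elim: s => [|i s IH] sS s0 sf.
    by rewrite /X /Y !big_nil oppr0 (lin_on0 Ssub fl).
  have Ss j : List.In j s -> S j.1.2 by move=> js; apply: sS; right.
  have := IH Ss (fun j js => s0 j (or_intror js)) (fun j js => sf j (or_intror js)).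
  rewrite /X /Y !big_cons -/(X w s) -/(Y w s) fl; last exact: XS.
    have i0 : 0 <= i.1.1 by apply: s0; left.
    have := ler_wpM2l i0 (sf i (or_introl erefl)); rewrite mulrN.
    by move: (i.1.1 * (_ / _)) => r1; lra.
  by apply: (subspaceB Ssub) => //; apply: sS; left.
have hfX := fX l' l'S l'0 l'f; have SX := XS l' l'S.
have val_ge0 : 0 <= val w l' t'.
  have := fq (X w l' + t' *: w) (subspaceD Ssub SX (subspaceZ Ssub t' Sw)).
  rewrite (lin_onD fl) ?(lin_onZ Ssub fl) //; last exact: (subspaceZ Ssub t' Sw).
  have := ler_wpM2l t'0 fw; rewrite /val /q.
  by move: (X w l') (Y w l') hfX => x1 x2; lra.
have hdiff := val_diff w d l'0 t'0.
have : lipc * (A l' + t') * `|w - d| <= lipc * (A l' + t') * r.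
  apply: ler_wpM2l (ltW hm).
  exact: mulr_ge0 (ltW lipc0) (addr_ge0 (A_ge0 l'0) t'0).
move: l'val hdiff val_ge0; rewrite -/r.
move: (val w l' t') (val d l' t') (A l') => v1 v2 a; clearbody r.
by rewrite mulrAC; move: (lipc * _ * r) => z; lra.
Qed.

End SeparableReduction.

(** * Asplund spaces *)

Section SeparableDuals.
Context {R : realType}.

Lemma countable_enum (T : Type) (D : set T) (y0 : T) : countable D -> D y0 ->
  exists g : nat -> T, (forall n, D (g n)) /\ forall y, D y -> exists n, g n = y.
Proof.
move=> /pfcard_geP [D0|[f]] Dy0; first by exfalso; rewrite D0 in Dy0.
exists f; split=> [n|y Dy]; first exact: funS.
by have [n _ <-] := @surj _ _ _ _ f y Dy; exists n.
Qed.

Lemma asplund_separable_duals (X : banachType R) : asplund X ->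
  @separable_duals R X.
Proof.
move=> aX S Ssub [x [Sx xd]].
have [|D [Dc DS Dd]] := aX S Ssub.
  exists (range x); split.
  - exact: card_image_le.
  - by move=> _ [n _ <-].
  - by move=> w Sw e e0; have [n hn] := xd w Sw e e0; exists (x n); [exists n|].
have bnd_dual f : lin_on S f -> bounded_on S f -> dual_on S f.
  move=> fl [M fM]; split=> //.
  apply/subspace_continuousP => w Sw; apply/cvgrPdist_lt => e e0.
  have M1 : 0 < `|M| + 1 by rewrite ltr_wpDl.
  have ec : 0 < e / (`|M| + 1) by rewrite divr_gt0.
  have := nbhsx_ballx w _ ec; rewrite -ball_normE /= near_withinE.
  apply: filterS => u /= wu Su.
  rewrite -(lin_onB Ssub fl) //; apply: le_lt_trans (fM _ (subspaceB Ssub Sw Su)) _.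
  apply: (@le_lt_trans _ _ ((`|M| + 1) * `|w - u|)).
    by rewrite ler_wpM2r //; have := ler_norm M; lra.
  by rewrite mulrC -ltr_pdivlMr.
have dual_bnd f : dual_on S f -> lin_on S f /\ bounded_on S f.
  move=> [fl fc]; split=> //.
  have /subspace_continuousP /(_ 0 Ssub.1) /cvgrPdist_lt /(_ _ ltr01) := fc.
  rewrite near_withinE => /nbhs_ballP [r /= r0]; rewrite -ball_normE /= => hr.
  (* The bound comes from the multiple of [w] of norm r / 2, where |f| < 1. *)
  exists (2 / r) => w Sw; have [->|w0] := eqVneq w 0.
    by rewrite (lin_on0 Ssub fl) !normr0 mulr0.
  have nw : 0 < `|w| by rewrite normr_gt0.
  have := hr ((r / 2 / `|w|) *: w); rewrite /ball_ /= sub0r normrN normrZ.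
  rewrite (@gtr0_norm _ (r / 2 / `|w|)) ?divr_gt0 // divfK ?gt_eqF //.
  rewrite gtr_pMr // invf_lt1 // ltr1n => /(_ isT (subspaceZ Ssub _ Sw)).
  rewrite /from_subspace (lin_on0 Ssub fl) sub0r normrN (lin_onZ Ssub fl) // normrM.
  rewrite (@gtr0_norm _ (r / 2 / `|w|)) ?divr_gt0 //.
  have k0 : 0 < 2 / r * `|w| by rewrite mulr_gt0 // divr_gt0.
  move=> /ltW /(ler_wpM2l (ltW k0)); rewrite mulr1 mulrA.
  suff -> : 2 / r * `|w| * (r / 2 / `|w|) = 1 by rewrite mul1r.
  have w0' : `|w| != 0 by rewrite gt_eqF.
  have r0' : r != 0 by rewrite gt_eqF.
  by field; rewrite w0' r0'.
have close f y : dual_on S f -> dual_on S y -> forall e, 0 < e ->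
    dual_dist_on S f y < e -> forall w, S w -> `|f w - y w| <= e * `|w|.
  move=> /dual_bnd [fl [M fM]] /dual_bnd [yl [N yN]] e e0 hd w Sw.
  have [->|w0] := eqVneq w 0.
    by rewrite (lin_on0 Ssub fl) (lin_on0 Ssub yl) subrr !normr0 mulr0.
  have nw : 0 < `|w| by rewrite normr_gt0.
  have : `|f (`|w|^-1 *: w) - y (`|w|^-1 *: w)| <= dual_dist_on S f y.
    apply: (@le_sup_image _ _ [set z | S z /\ `|z| <= 1]
      (fun z => `|f z - y z|) (`|M| + `|N|)); last first.
      split; first exact: subspaceZ.
      by rewrite normrZ normfV normr_id mulVf ?gt_eqF.
    move=> z [Sz z1]; apply: le_trans (ler_normB _ _) _.
    have bd C (k : R) : `|k| <= C * `|z| -> `|k| <= `|C|.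
      move=> /le_trans; apply; apply: le_trans (ler_norm _) _.
      by rewrite normrM normr_id ler_piMr.
    by apply: lerD; [apply: bd (fM z Sz) | apply: bd (yN z Sz)].
  rewrite (lin_onZ Ssub fl) // (lin_onZ Ssub yl) // -mulrBr normrM normfV normr_id.
  by rewrite mulrC ler_pdivrMr // => h; apply: le_trans h _; rewrite ler_pM2r // ltW.
have zdual : dual_on S (cst 0 : X -> R).
  apply: bnd_dual; first by move=> a u v _ _; rewrite /= mulr0 addr0.
  by exists 0 => w _; rewrite normr0 mul0r.
have [y0 Dy0 _] := Dd _ zdual _ ltr01.
have [g [gD gsurj]] := countable_enum Dc Dy0.
exists g; split=> [n|f fl fb e e0]; first exact/dual_bnd/DS.
have fd := bnd_dual f fl fb.
have [y Dy hy] := Dd f fd e e0; have [n gn] := gsurj y Dy.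
by exists n; rewrite gn; apply: close (DS _ Dy) _ e0 hy.
Qed.

(** A functional on [S] does not split along the factors, since [S] need not contain (u, 0) with (u,
    v). It is extended to the whole product by Hahn-Banach; the extension splits, and each part is
    approximated on a projection of [S], which is again separable. *)
Lemma separable_duals_prod (X Y : normedModType R) :
  separable_duals (R := R) (W := X) -> separable_duals (R := R) (W := Y) ->
  separable_duals (R := R) (W := (X * Y)%type).
Proof.
move=> aX aY S Ssub [x [Sx xd]].
have norm1 (w : X * Y) : `|w.1| <= `|w| by rewrite prod_normE le_max lexx.
have norm2 (w : X * Y) : `|w.2| <= `|w| by rewrite prod_normE le_max lexx orbT.
have [||g1 [g1b g1d]] := aX (fst @` S).
- split; first by exists 0 => //; exact: Ssub.1.
  move=> a _ _ [u Su <-] [v Sv <-]; exists (a *: u + v) => //; exact: Ssub.2.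
- exists (fst \o x); split=> [n|_ [w Sw <-] e e0]; first by exists (x n).
  by have [n hn] := xd w Sw e e0; exists n; exact: le_lt_trans (norm1 (w - x n)) hn.
have [||g2 [g2b g2d]] := aY (snd @` S).
- split; first by exists 0 => //; exact: Ssub.1.
  move=> a _ _ [u Su <-] [v Sv <-]; exists (a *: u + v) => //; exact: Ssub.2.
- exists (snd \o x); split=> [n|_ [w Sw <-] e e0]; first by exists (x n).
  by have [n hn] := xd w Sw e e0; exists n; exact: le_lt_trans (norm2 (w - x n)) hn.
pose dec n := odflt (0%N, 0%N) (@choice.unpickle (nat * nat)%type n).
exists (fun n w => g1 (dec n).1 w.1 + g2 (dec n).2 w.2); split.
  move=> n; have [l1 [C1 b1]] := g1b (dec n).1; have [l2 [C2 b2]] := g2b (dec n).2.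
  split.
    move=> a u v Su Sv /=; rewrite l1; [|by exists u|by exists v].
    by rewrite l2; [ring|by exists u|by exists v].
  exists (`|C1| + `|C2|) => w Sw; apply: le_trans (ler_normD _ _) _.
  have bd (C k r : R) : `|k| <= C * r -> 0 <= r -> r <= `|w| -> `|k| <= `|C| * `|w|.
    move=> h r0 rw; apply: le_trans h _; apply: (@le_trans _ _ (`|C| * r)).
      by rewrite ler_wpM2r // ler_norm.
    by rewrite ler_wpM2l.
  rewrite mulrDl; apply: lerD.
    by apply: bd (b1 _ _) _ _ => //; exists w.
  by apply: bd (b2 _ _) _ _ => //; exists w.
move=> f fl [M fM] e e0.
have nsub : sublinear (fun w : X * Y => `|M| * `|w|).
  split=> [u v|a u a0]; first by rewrite -mulrDr ler_wpM2l // ler_normD.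
  by rewrite normrZ ger0_norm // mulrCA.
(* The constraints of h and - h together force [F] to agree with [f] on [S]. *)
have [|F [Fl Fle Fge]] := @hahn_banach_cone R (X * Y)%type _
    [set h | S h.1 /\ h.2 = - f h.1] nsub.
  move=> w s H.
  have [Sw ->] : S w /\ s = - f w.
    elim: H => [|a h r y s' a0 [/= Sh ->] _ [Sy ->]].
      by split; [exact: Ssub.1 | rewrite (lin_on0 Ssub fl) oppr0].
    by split; [exact: Ssub.2 | rewrite fl //; ring].
  rewrite subr_ge0; apply: le_trans (ler_norm _) _; apply: le_trans (fM w Sw) _.
  by rewrite ler_wpM2r // ler_norm.
have Flin (T : set (X * Y)) : lin_on T F by move=> a u v _ _; exact: Fl.
have Tsub : linear_subspace [set: X * Y] by split.
have F_le w : `|F w| <= `|M| * `|w|.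
  by apply: (lin_on_le_norm Tsub (Flin setT) (p := fun w => `|M| * `|w|)).
have Ff w : S w -> F w = f w.
  move=> Sw; apply/eqP; rewrite eq_le; apply/andP; split; last first.
    by have := Fge w (- f w); rewrite opprK; apply.
  have := Fge (- w) (f w); rewrite /= (lin_onN Ssub fl) // opprK.
  move=> /(_ (conj (subspaceN Ssub Sw) erefl)).
  by rewrite (lin_onN Tsub (Flin setT)) // lerN2.
have F12 (w : X * Y) : F w = F (w.1, 0) + F (0, w.2).
  rewrite -(lin_onD (Flin setT)) //; congr F; case: w => u v.
  by congr pair; rewrite ?addr0 ?add0r.
have e2 : 0 < e / 2 by rewrite divr_gt0.
have pairD1 (a : R) (u v : X) : (a *: u + v, 0 : Y) = a *: (u, 0) + (v, 0).
  by apply: injective_projections; rewrite /= ?scaler0 ?addr0.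
have pairD2 (a : R) (u v : Y) : (0 : X, a *: u + v) = a *: (0, u) + (0, v).
  by apply: injective_projections; rewrite /= ?scaler0 ?addr0.
have [||i hi] := g1d (fun u => F (u, 0)) _ _ _ e2.
- by move=> a u v _ _; rewrite pairD1 Fl.
- exists `|M| => u _; apply: le_trans (F_le _) _.
  by rewrite prod_normE /= normr0 max_l.
have [||j hj] := g2d (fun u => F (0, u)) _ _ _ e2.
- by move=> a u v _ _; rewrite pairD2 Fl.
- exists `|M| => u _; apply: le_trans (F_le _) _.
  by rewrite prod_normE /= normr0 max_r.
exists (choice.pickle (i, j)) => w Sw; rewrite /dec choice.pickleK /= -Ff // F12.
have h1 := hi w.1 (ex_intro2 _ _ w Sw erefl).
have h2 := hj w.2 (ex_intro2 _ _ w Sw erefl).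
have : e / 2 * `|w.1| <= e / 2 * `|w| by rewrite ler_pM2l.
have : e / 2 * `|w.2| <= e / 2 * `|w| by rewrite ler_pM2l.
by move: h1 h2; rewrite !ler_norml; lra.
Qed.

End SeparableDuals.

(** * Metric spaces *)

Section MetricRegularity.
Context {R : realType}.

Lemma complete_mdist (X : completeMetricType R) (u : nat -> X) :
  cauchy_seq mdist u -> exists x, converges mdist u x.
Proof.
move=> uC.
have /cauchy_exP/cauchy_cvgP/cvg_ex [l ul] : cauchy_ex (u @ \oo).
  move=> e e0; have [N hN] := uC _ e0; exists (u N).
  by exists N => // n /= Nn; rewrite ballEmdist /=; exact: hN.
exists l => e e0.
have : \forall n \near u @ \oo, ball l e n by apply: ul; exact: nbhsx_ballx.
case=> N _ hN; exists N => n /hN; by rewrite /= ballEmdist /= metric_sym.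
Qed.

Lemma closed_avoid (X Y : metricType R) (A : set (X * Y)) x y :
  closed A -> ~ A (x, y) -> exists2 r : R, 0 < r &
  forall u v, mdist x u < r -> mdist y v < r -> ~ A (u, v).
Proof.
move=> Ac nA; have : nbhs (x, y) (~` A) by apply: open_nbhs_nbhs; split => //; exact: closed_openC.
move=> /nbhs_ballP [r /= r0 hr]; exists r => // u v xu yv.
by apply: (hr (u, v)); split; rewrite /= ballEmdist.
Qed.

Section Gdist.
Context {X Y : metricType R} (gamma : R).
Hypothesis gamma_gt0 : 0 < gamma.

Lemma gdist_sym (w z : X * Y) : gdist gamma w z = gdist gamma z w.
Proof. by rewrite /gdist (metric_sym w.1) (metric_sym w.2). Qed.

Lemma gdist_fst (w z : X * Y) : mdist w.1 z.1 <= gdist gamma w z.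
Proof. by rewrite /gdist le_max lexx. Qed.

Lemma gdist_snd (w z : X * Y) : gamma * mdist w.2 z.2 <= gdist gamma w z.
Proof. by rewrite /gdist le_max lexx orbT. Qed.

Lemma gdist_ge0 (w z : X * Y) : 0 <= gdist gamma w z.
Proof. exact: le_trans (mdist_ge0 _ _) (gdist_fst w z). Qed.

Lemma gdistxx (w : X * Y) : gdist gamma w w = 0.
Proof. by rewrite /gdist !mdistxx mulr0 maxxx. Qed.

Lemma gdist_triangle (y x z : X * Y) :
  gdist gamma x z <= gdist gamma x y + gdist gamma y z.
Proof.
rewrite {1}/gdist ge_max; apply/andP; split.
  by apply: le_trans (metric_triangle _ _ _) (lerD (gdist_fst x y) (gdist_fst y z)).
apply: le_trans (lerD (gdist_snd x y) (gdist_snd y z)).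
by rewrite -mulrDr ler_pM2l // metric_triangle.
Qed.

Lemma gdist_sep (x y : X * Y) : gdist gamma x y <= 0 -> x = y.
Proof.
move=> xy; apply: injective_projections; apply: mdist_positivity; apply/eqP.
  by rewrite eq_le mdist_ge0 (le_trans (gdist_fst x y)).
rewrite eq_le mdist_ge0 andbT -(ler_pM2l gamma_gt0) mulr0.
exact: le_trans (gdist_snd x y) xy.
Qed.

Lemma gdist_lipschitz_lsc (E : set (X * Y)) f (C : R) : 0 < C ->
  (forall w z, f w <= f z + C * gdist gamma w z) ->
  seq_lsc (gdist gamma) E f.
Proof.
move=> C0 fC u x _ _ ux e e0; have [N hN] := ux _ (divr_gt0 e0 C0).
exists N => n /hN; rewrite ltr_pdivlMr // gdist_sym mulrC => h.
by have := fC x (u n); lra.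
Qed.

End Gdist.

Lemma closed_gdist_complete (X Y : completeMetricType R) (gamma : R)
    (A : set (X * Y)) : 0 < gamma ->
  closed A -> cauchy_complete (gdist gamma) A.
Proof.
move=> g0 Ac u Au uC.
have [|x ux] := @complete_mdist X (fst \o u).
  move=> e e0; have [N hN] := uC e e0; exists N => m n Nm Nn.
  exact: le_lt_trans (gdist_fst gamma _ _) (hN m n Nm Nn).
have [|y uy] := @complete_mdist Y (snd \o u).
  move=> e e0; have [N hN] := uC _ (mulr_gt0 g0 e0); exists N => m n Nm Nn.
  rewrite -(ltr_pM2l g0).
  exact: le_lt_trans (gdist_snd gamma _ _) (hN m n Nm Nn).
exists (x, y).
  apply: contrapT => nA; have [r r0 hr] := closed_avoid Ac nA.
  have [N hN] := ux r r0; have [M hM] := uy r r0.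
  apply: (hr (u (maxn N M)).1 (u (maxn N M)).2).
  - by rewrite metric_sym; apply: hN; rewrite leq_maxl.
  - by rewrite metric_sym; apply: hM; rewrite leq_maxr.
  - by rewrite -surjective_pairing.
move=> e e0; have [N hN] := ux e e0; have [M hM] := uy _ (divr_gt0 e0 g0).
exists (maxn N M) => n; rewrite geq_max => /andP[/hN /= h1 /hM /= h2].
by rewrite /gdist gt_max h1 /= mulrC -ltr_pdivlMr.
Qed.

(** The weights are a, (b - a) / 2, (b - a) / 4 and so on, with partial sums at most b. The first
    one gives the estimate from [z0]; the triangle inequality merges all penalties into one centered
    at [z]. *)
Lemma ekeland (X Y : completeMetricType R) (gamma : R) (A : set (X * Y))
    (f : X * Y -> R) (C a b : R) (z0 : X * Y) :
  0 < gamma -> closed A -> 0 < C ->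
  (forall w z, f w <= f z + C * gdist gamma w z) -> (forall w, 0 <= f w) ->
  A z0 -> 0 < a -> a < b ->
  exists z, [/\ A z, f z + a * gdist gamma z z0 <= f z0 &
    forall w, A w -> f z <= f w + b * gdist gamma w z].
Proof.
move=> g0 Ac C0 fC f0 Az0 a0 ab.
pose m (i : nat) : R := if i is j.+1 then (b - a) / 2 ^+ i else a.
have m0 i : 0 < m i by case: i => [//|i]; rewrite divr_gt0 ?subr_gt0 // exprn_gt0.
have msum n : \sum_(i < n) m i <= b.
  have : \sum_(i < n.+1) m i = b - (b - a) / 2 ^+ n.
    elim: n => [|n IH]; first by rewrite big_ord_recl big_ord0 /= expr0 divr1; lra.
    rewrite big_ord_recr /= IH exprS.
    have : (2 : R) ^+ n != 0 by rewrite expf_neq0.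
    by move=> h; field.
  rewrite big_ord_recr /= => h; have := m0 n.
  have : 0 < (b - a) / 2 ^+ n by rewrite divr_gt0 ?subr_gt0 // exprn_gt0.
  lra.
have [|||||||z [t [Az At hz zmin]]] := @variational_principle R (X * Y)%type
  (gdist gamma) (gdist_sym gamma) (gdist_triangle g0) (gdist_sep g0) A f
  (gdist gamma) m z0 (closed_gdist_complete g0 Ac) (gdist_lipschitz_lsc C0 fC).
- move=> c _; apply: (@gdist_lipschitz_lsc _ _ _ _ _ 1) => // w z.
  by rewrite mul1r addrC; exact: gdist_triangle.
- by move=> w c _ _; exact: gdist_ge0.
- by move=> c _; exact: gdistxx.
- by move=> r r0; exists r.
- exact: m0.
- by exists 0 => w _; exact: f0.
- exact: Az0.
exists z; split=> // w Aw; have [n hn] := zmin w Aw.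
have := hn n (leqnn n).
have : \sum_(j < n) m j * gdist gamma w (t j) <=
    \sum_(j < n) m j * gdist gamma z (t j) + (\sum_(j < n) m j) * gdist gamma w z.
  rewrite mulr_suml -big_split /=; apply: ler_sum => j _.
  rewrite -mulrDr ler_pM2l // addrC; exact: gdist_triangle.
have := ler_wpM2r (gdist_ge0 gamma w z) (msum n).
move: (\sum_(j < n) m j * gdist gamma w (t j)) => s1.
move: (\sum_(j < n) m j * gdist gamma z (t j)) => s2; lra.
Qed.

Lemma ereal_lt_real (a : R) (b : \bar R) : (a%:E < b)%E ->
  exists2 c, a < c & (c%:E < b)%E.
Proof.
case: b => [b| |//] h; last by exists (a + 1); rewrite ?ltry //; lra.
rewrite lte_fin in h; exists ((a + b) / 2); rewrite ?lte_fin; lra.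
Qed.

(* A failure of the Aubin estimate yields, by Ekeland's principle, a point
   satisfying (R) at which the slope of d(., ybar) is smaller than l' / l. *)
Lemma aubin_of_no_small_slope (P : metricType R) (X Y : completeMetricType R)
    (F : P -> X -> set Y) pbar xbar ybar (l l' : R) (eta delta mu : \bar R) gamma :
  0 < l -> 0 < l' -> 0 < gamma ->
  (forall p, eball pbar eta p -> closed (gph (F p))) ->
  recedes F pbar xbar ybar l' eta delta mu ->
  (forall p x y c, req F pbar xbar ybar l l' eta delta mu p x y ->
     0 < c -> c < l' / l ->
     (forall u v, F p u v ->
        mdist y ybar <= mdist v ybar + c * gdist gamma (u, v) (x, y)) -> False) ->
  aubin (fun p => [set x | F p x ybar]) pbar xbar l eta delta mu.
Proof.
move=> l0 l'0 g0 Fc rec H p p' x0 bp bp' pmu Fx0 bx0.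
rewrite leNgt; apply/negP => big.
have [rho0|] := eqVneq (mdist p p') 0.
  have pp : p = p' by exact: mdist_positivity.
  move: big; rewrite rho0 mulr0 ltNge => /negP; apply.
  by apply: ereal_inf_lbound; exists x0; rewrite ?mdistxx //= pp.
move=> ne; have rho0 : 0 < mdist p p' by rewrite lt_neqAle eq_sym ne mdist_ge0.
have [s ls sbig] := ereal_lt_real big.
have [r1 hr1 r1mu] := ereal_lt_real pmu.
(* [r] slightly exceeds d(p, p'), which makes the recession estimate strict; r < mu and l r <= s
   will place the Ekeland point in (R). *)
pose r := Num.min r1 (s / l).
have hr : mdist p p' < r by rewrite lt_min hr1 ltr_pdivlMr // mulrC.
have r0 : 0 < r by exact: lt_trans hr.
have rmu : (r%:E < mu)%E by apply: le_lt_trans r1mu; rewrite lee_fin ge_min lexx.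
have lrs : l * r <= s by rewrite mulrC -ler_pdivlMr // ge_min lexx orbT.
have [_ [y0 Fy0 <-] hy0] : exists2 y, [set (mdist ybar a)%:E | a in F p x0] y &
    (y < (l' * r)%:E)%E.
  apply: ereal_inf_lt; apply: le_lt_trans (rec x0 p p' bx0 bp bp' pmu Fx0) _.
  by rewrite lte_fin ltr_pM2l.
rewrite lte_fin in hy0.
pose f (w : X * Y) := mdist w.2 ybar.
have lr0 : 0 < l * r by rewrite mulr_gt0.
(* a (l r) is the midpoint of f (x0, y0) and l' r: above the former, so that Ekeland moves by less
   than l r; below the latter, so that a < l' / l. *)
pose a := (f (x0, y0) + l' * r) / 2 / (l * r).
have fl : f (x0, y0) < l' * r by rewrite /f /= metric_sym.
have f_ge0 w : 0 <= f w by exact: mdist_ge0.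
have l'r0 : 0 < l' * r by rewrite mulr_gt0.
have a0 : 0 < a.
  by rewrite /a !divr_gt0 // ltr_wpDl.
have alr : a * (l * r) = (f (x0, y0) + l' * r) / 2 by rewrite divfK // gt_eqF.
have all : a < l' / l.
  rewrite ltr_pdivlMr // -(ltr_pM2r r0) -mulrA alr; lra.
pose b := (a + l' / l) / 2.
have ab : a < b by rewrite /b; lra.
have bl : b < l' / l by rewrite /b; lra.
have gi : 0 < gamma^-1 by rewrite invr_gt0.
have [||[x y] [Fxy hz zmin]] := @ekeland X Y gamma (gph (F p)) f gamma^-1 a b (x0, y0)
   g0 (Fc p bp) gi _ f_ge0 _ a0 ab.
- move=> w z; rewrite /f; apply: le_trans (metric_triangle _ z.2 _) _.
  rewrite addrC lerD2l mulrC ler_pdivlMr // mulrC; exact: gdist_snd.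
- exact: Fy0.
have near0 : gdist gamma (x, y) (x0, y0) < l * r.
  rewrite -(ltr_pM2l a0) alr; have := f_ge0 (x, y); lra.
have xx0 : mdist x0 x < l * r.
  by rewrite metric_sym; exact: le_lt_trans (gdist_fst gamma _ _) near0.
have fxy : f (x, y) < l' * r.
  apply: le_lt_trans fl; apply: le_trans hz.
  by rewrite lerDl; exact: mulr_ge0 (ltW a0) (gdist_ge0 _ _ _).
apply: (H p x y b) => //; last 2 first.
- exact: lt_trans a0 ab.
- by move=> u v Fuv; exact: (zmin (u, v) Fuv).
have lmu (k : R) : 0 < k -> ((k * r)%:E < k%:E * mu)%E.
  by move=> k0; rewrite EFinM lte_pmul2l.
split=> //.
- apply: (@le_lt_trans _ _ (mdist xbar x0 + mdist x0 x)%:E).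
    by rewrite lee_fin metric_triangle.
  rewrite EFinD; apply: lteD => //; apply: lt_trans (lmu l l0).
  by rewrite lte_fin.
- move=> Fx; move: sbig; rewrite ltNge => /negP; apply.
  apply: (@le_trans _ _ (mdist x0 x)%:E); first by apply: ereal_inf_lbound; exists x.
  by rewrite lee_fin; apply: le_trans lrs; exact: ltW.
- apply: lt_trans (lmu l' l'0); rewrite lte_fin metric_sym; exact: fxy.
Qed.

(** The Ekeland inequality bounds the quotient by c at every other point of the graph, so the upper
    limit is at most c < l' / l. *)
Lemma cond_slope_aubin (P : metricType R) (X Y : completeMetricType R)
    (F : P -> X -> set Y) pbar xbar ybar (l l' : R) (eta delta mu : \bar R) :
  0 < l -> 0 < l' ->
  (forall p, eball pbar eta p -> closed (gph (F p))) ->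
  recedes F pbar xbar ybar l' eta delta mu ->
  cond_slope F pbar xbar ybar l l' eta delta mu ->
  aubin (fun p => [set x | F p x ybar]) pbar xbar l eta delta mu.
Proof.
move=> l0 l'0 Fc rec [gamma g0 H].
apply: (aubin_of_no_small_slope l0 l'0 g0 Fc rec) => p x y c hr c0 cl slope.
have := H p x y hr; apply/negP; rewrite -ltNge.
apply: (@le_lt_trans _ _ c%:E); last by rewrite lte_fin.
rewrite limf_esupE; set Wd := within _ _; set h := (fun w : X * Y => _%:E).
apply: (@le_trans _ _ (ereal_sup (h @` [set w | gph (F p) w /\ w <> (x, y)]))).
  apply: ereal_inf_lbound; exists [set w | gph (F p) w /\ w <> (x, y)] => //.
  by apply: (@filterE _ (nbhs (x, y))) => w [h1 h2 _ _]; split.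
apply: ge_ereal_sup => _ [[u v] [Fuv ne] <-]; rewrite /h lee_fin /=.
have gp : 0 < gdist gamma (u, v) (x, y).
  rewrite ltNge; apply/negP => /(gdist_sep g0); exact: ne.
by rewrite ler_pdivrMr //; have := slope u v Fuv; lra.
Qed.

End MetricRegularity.

(** * Multipliers in normed spaces *)

Section DualNorm.
Context {R : realType}.

Section OneSpace.
Context {Z : normedModType R}.
Implicit Types f g : Z -> R.

Let Tsub : linear_subspace [set: Z]. Proof. by split. Qed.

Lemma scalar_lin_on f : scalar f -> lin_on setT f.
Proof. by move=> fl a u v _ _; exact: fl. Qed.

Lemma scalar0 f : scalar f -> f 0 = 0.
Proof. by move=> /scalar_lin_on; exact: lin_on0. Qed.

Lemma scalarN f x : scalar f -> f (- x) = - f x.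
Proof. by move=> /scalar_lin_on fl; exact: (lin_onN Tsub fl). Qed.

Lemma scalarZl f a x : scalar f -> f (a *: x) = a * f x.
Proof. by move=> /scalar_lin_on fl; exact: (lin_onZ Tsub fl). Qed.

Lemma scalarD f x y : scalar f -> f (x + y) = f x + f y.
Proof. by move=> /scalar_lin_on fl; exact: (lin_onD fl). Qed.

Lemma scalar_le_norm f M : scalar f -> (forall x, f x <= M * `|x|) ->
  forall x, `|f x| <= M * `|x|.
Proof.
move=> /scalar_lin_on fl fM x.
by apply: (lin_on_le_norm Tsub fl (p := fun x => M * `|x|)).
Qed.

Lemma dual_of_le f M : scalar f -> (forall x, f x <= M * `|x|) -> dual f.
Proof.
move=> fl /(scalar_le_norm fl) fM; split=> // x; apply/cvgrPdist_lt => e e0.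
have M1 : 0 < `|M| + 1 by rewrite ltr_wpDl.
have ec : 0 < e / (`|M| + 1) by rewrite divr_gt0.
have := nbhsx_ballx x _ ec; rewrite -ball_normE /=.
apply: filterS => u /= xu; rewrite -[- f u]scalarN // -scalarD //.
apply: le_lt_trans (fM _) _; apply: (@le_lt_trans _ _ ((`|M| + 1) * `|x - u|)).
  by rewrite ler_wpM2r //; have := ler_norm M; lra.
by rewrite mulrC -ltr_pdivlMr.
Qed.

Lemma dual_norm_le f M : (forall x, `|x| <= 1 -> `|f x| <= M) -> dual_norm f <= M.
Proof.
by move=> h; apply: (@sup_image_le R Z [set z | `|z| <= 1]) => //; exists 0; rewrite /= normr0.
Qed.

Lemma le_dual_norm f M x : scalar f -> (forall x, `|f x| <= M * `|x|) ->
  `|f x| <= dual_norm f * `|x|.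
Proof.
move=> fl fM; have [->|x0] := eqVneq x 0.
  by rewrite scalar0 // !normr0 mulr0.
have nx : 0 < `|x| by rewrite normr_gt0.
have : `|f (`|x|^-1 *: x)| <= dual_norm f.
  apply: (@le_sup_image R Z [set z | `|z| <= 1] (fun z => `|f z|) `|M|).
    move=> z /= z1; apply: le_trans (fM z) _; apply: le_trans (ler_norm _) _.
    by rewrite normrM normr_id ler_piMr.
  by rewrite /= normrZ normfV normr_id mulVf ?gt_eqF.
by rewrite scalarZl // normrM normfV normr_id mulrC ler_pdivrMr.
Qed.

Lemma dual_norm_ge0 f : 0 <= dual_norm f.
Proof.
have [[M hM]|nb] := pselect (has_ubound [set `|f z| | z in [set z | `|z| <= 1]]).
  apply: (@le_trans _ _ `|f 0|) => //; apply: ub_le_sup; first by exists M.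
  by exists 0; rewrite //= normr0.
(* An unbounded set has [sup] equal to 0. *)
by rewrite /dual_norm sup_out // => -[_ /nb].
Qed.

Lemma dual_normN f : dual_norm (\- f) = dual_norm f.
Proof.
rewrite /dual_norm; congr sup; apply/seteqP.
by split=> _ [z z1 <-]; exists z; rewrite //= normrN.
Qed.

Lemma dualN f : dual f -> dual (\- f).
Proof.
move=> [fl fc]; split=> [a x y|]; first by rewrite /= fl /=; ring.
by move=> x; apply: cvgN; exact: fc.
Qed.

Lemma dualD f g : dual f -> dual g -> dual (f \+ g).
Proof.
move=> [fl fc] [gl gc]; split=> [a x y|]; first by rewrite /= fl gl /=; ring.
by move=> x; apply: cvgD; [exact: fc | exact: gc].
Qed.

End OneSpace.

Lemma dual_pair (X Y : normedModType R) (f : X -> R) (g : Y -> R) :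
  dual f -> dual g -> dual (fun w : X * Y => f w.1 + g w.2).
Proof.
move=> [fl fc] [gl gc]; split=> [a x y|]; first by rewrite /= fl gl /=; ring.
move=> x; apply: (@cvgD _ _ _ _ _ (fun w : X * Y => f w.1) (fun w : X * Y => g w.2)).
  by apply: (@cvg_comp _ _ _ fst f _ (nbhs x.1)); [exact: cvg_fst | exact: fc].
by apply: (@cvg_comp _ _ _ snd g _ (nbhs x.2)); [exact: cvg_snd | exact: gc].
Qed.

(** The dual of a maximum norm is a sum norm: the signs of [a] and [b] are chosen independently, and
    [b] is scaled by [gamma^-1]. *)
Lemma dual_gdist_le (X Y : normedModType R) (f : X -> R) (g : Y -> R) (gamma C : R) :
  0 < gamma -> 0 <= C -> scalar f -> scalar g ->
  (forall a b, f a + g b <= C * Num.max `|a| (gamma * `|b|)) ->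
  dual_norm f + gamma^-1 * dual_norm g <= C.
Proof.
move=> g0 C0 fl gl fgC; have gi : 0 < gamma^-1 by rewrite invr_gt0.
have key a b : `|a| <= 1 -> `|b| <= 1 -> `|f a| + gamma^-1 * `|g b| <= C.
  move=> a1 b1.
  have sgn (Z : normedModType R) (h : Z -> R) (z : Z) : scalar h ->
      exists2 z', `|z'| = `|z| & h z' = `|h z|.
    move=> hl; have [h0|h0] := leP 0 (h z); first by exists z; rewrite ?ger0_norm.
    by exists (- z); rewrite ?normrN // scalarN // ltr0_norm.
  have [a' na <-] := sgn _ f a fl; have [b' nb <-] := sgn _ g b gl.
  rewrite -scalarZl //.
  apply: le_trans (fgC _ _) _; rewrite -[leRHS]mulr1 ler_wpM2l // ge_max na a1 /=.
  by rewrite normrZ gtr0_norm // mulrA divff ?gt_eqF // mul1r nb.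
rewrite -lerBrDr; apply: dual_norm_le => a a1; rewrite lerBrDr addrC -lerBrDr.
rewrite -ler_pdivlMl ?invr_gt0 //; apply: dual_norm_le => b b1.
by rewrite ler_pdivlMl ?invr_gt0 // lerBrDr addrC; exact: key.
Qed.

End DualNorm.

(** * Clarke tangent cones *)

Section ClarkeTangent.
Context {R : realType} {Z : normedModType R}.
Variables (Omega : set Z) (zbar : Z).

Let T := clarke_tangent Omega zbar.

Lemma clarke_tangent0 : T 0.
Proof.
move=> z t zO _ _ _; exists (fun=> 0); first exact: cvg_cst.
by move=> k; rewrite scaler0 addr0.
Qed.

(** This uses the quantifier over all base sequences: [s'] is applied along z k + t k w k, which
    stays in [Omega] and has the same limit. *)
Lemma clarke_tangentD s s' : T s -> T s' -> T (s + s').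
Proof.
move=> Ts Ts' z t zO zz t0 tt; have [w ws wO] := Ts z t zO zz t0 tt.
have zz' : (fun k => z k + t k *: w k) @ \oo --> zbar.
  rewrite -[zbar]addr0 -(scale0r s); apply: cvgD => //; exact: cvgZ.
have [w' ws' wO'] := Ts' _ t wO zz' t0 tt.
exists (fun k => w k + w' k); first exact: cvgD.
by move=> k; rewrite scalerDr addrA.
Qed.

Lemma clarke_tangentZ a s : 0 <= a -> T s -> T (a *: s).
Proof.
rewrite le_eqVlt => /orP[/eqP <-|a0] Ts.
  by rewrite scale0r; exact: clarke_tangent0.
move=> z t zO zz t0 tt; have [||w ws wO] := Ts z (fun k => a * t k) zO zz.
- by move=> k; rewrite mulr_gt0.
- by rewrite -(mulr0 a); apply: cvgM => //; exact: cvg_cst.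
exists (fun k => a *: w k); first by apply: cvgZ => //; exact: cvg_cst.
by move=> k; rewrite scalerA mulrC.
Qed.

Lemma clarke_tangent_approx s e d : Omega zbar -> T s -> 0 < e -> 0 < d ->
  exists t w, [/\ 0 < t, t < e, `|w - s| < d & Omega (zbar + t *: w)].
Proof.
move=> Oz Ts e0 d0.
have [||w ws wO] := Ts (fun=> zbar) (fun k => k.+1%:R^-1) (fun=> Oz) (cvg_cst _).
- by move=> k; rewrite invr_gt0.
- exact: cvg_harmonic.
have /cvgrPdist_lt /(_ d d0) [N _ hN] := ws.
have [M hM] := inv_natr_small e0.
exists (maxn N M).+1%:R^-1, (w (maxn N M)); split=> //.
- by apply: le_lt_trans hM; apply: inv_natr_le; rewrite leq_maxr.
- by rewrite distrC; apply: hN; rewrite /= leq_maxl.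
Qed.

End ClarkeTangent.

(** * Multipliers at a minimum over a graph *)

Section GraphMinimum.
Context {R : realType} {X Y : normedModType R}.
Variables (Omega : set (X * Y)) (ybar : Y) (z0 : X * Y) (c gamma : R).

(* In the coordinates [emb z] the objective, a distance to ybar plus a distance
   to z0, is the sublinear function [pen]. *)
Let W := (Y * (X * Y))%type.
Let pen (h : W) := `|h.1| + c * Num.max `|h.2.1| (gamma * `|h.2.2|).
Let emb (z : X * Y) : W := (z.2 - ybar, z - z0).
Let M := 1 + c * (1 + gamma).

Hypotheses (c_gt0 : 0 < c) (gamma_gt0 : 0 < gamma) (Oz0 : Omega z0)
  (z0_min : forall z, Omega z -> pen (emb z0) <= pen (emb z)).

Let pen_sub : sublinear pen.
Proof.
split=> [u v|a u a0]; rewrite /pen /=.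
  have := ler_normD u.1 v.1.
  have : Num.max `|u.2.1 + v.2.1| (gamma * `|u.2.2 + v.2.2|) <=
      Num.max `|u.2.1| (gamma * `|u.2.2|) + Num.max `|v.2.1| (gamma * `|v.2.2|).
    rewrite ge_max; apply/andP; split.
      by apply: le_trans (ler_normD _ _) (lerD _ _); rewrite le_max lexx.
    apply: (@le_trans _ _ (gamma * `|u.2.2| + gamma * `|v.2.2|)).
      by rewrite -mulrDr ler_pM2l // ler_normD.
    by apply: lerD; rewrite le_max lexx orbT.
  by move=> /(ler_wpM2l (ltW c_gt0)); rewrite mulrDr; lra.
rewrite !normrZ ger0_norm // (mulrCA gamma) -maxr_pMr //; ring.
Qed.

Let pen_ge0 h : 0 <= pen h.
Proof.
apply: addr_ge0 => //; apply: mulr_ge0 (ltW c_gt0) _.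
by rewrite le_max normr_ge0.
Qed.

Let norm_fst (A B : normedModType R) (w : A * B) : `|w.1| <= `|w|.
Proof. by rewrite prod_normE le_max lexx. Qed.

Let norm_snd (A B : normedModType R) (w : A * B) : `|w.2| <= `|w|.
Proof. by rewrite prod_normE le_max lexx orbT. Qed.

Let pen_le h : pen h <= M * `|h|.
Proof.
have h1 : `|h.1| <= `|h| := norm_fst h; have h2 : `|h.2| <= `|h| := norm_snd h.
have h3 : `|h.2.1| <= `|h.2| := norm_fst h.2.
have h4 : `|h.2.2| <= `|h.2| := norm_snd h.2.
have : Num.max `|h.2.1| (gamma * `|h.2.2|) <= (1 + gamma) * `|h|.
  have : 0 <= gamma * `|h| by rewrite mulr_ge0 // ltW.
  have := normr_ge0 h; have := le_trans h3 h2.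
  have : gamma * `|h.2.2| <= gamma * `|h|.
    by rewrite ler_pM2l // (le_trans h4 h2).
  by rewrite ge_max => *; apply/andP; split; lra.
move=> /(ler_wpM2l (ltW c_gt0)); rewrite /pen /M.
by move: (c * Num.max _ _) => m; move: h1; lra.
Qed.

Let M_gt0 : 0 < M.
Proof.
apply: ltr_pwDl => //; apply: mulr_ge0 (ltW c_gt0) _.
exact: addr_ge0 ler01 (ltW gamma_gt0).
Qed.

Let ys (f : W -> R) (k : Y) := f (k, 0).
Let e1 (f : W -> R) (a : X) := f (0, (a, 0)).
Let e2 (f : W -> R) (b : Y) := f (0, (0, b)).

Let split_f (f : W -> R) h : scalar f -> f h = ys f h.1 + (e1 f h.2.1 + e2 f h.2.2).
Proof.
move=> fl; rewrite /ys /e1 /e2 -!scalarD //; congr f.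
by case: h => k [a b] /=; congr (_, (_, _)); rewrite /= ?addr0 ?add0r.
Qed.

Let split_dual (f : W -> R) C : scalar f -> (forall h, f h <= C * `|h|) ->
  [/\ dual (ys f), dual (e1 f) & dual (e2 f)].
Proof.
move=> fl fC; split; apply: (@dual_of_le R _ _ C).
- move=> a u v; rewrite /ys -[a *: u + v]/(((a *: u + v, 0) : W).1).
  rewrite -fl; congr f; apply: injective_projections; rewrite //= scaler0 addr0 //.
- by move=> u; apply: le_trans (fC _) _; rewrite prod_normE /= normr0 max_l.
- move=> a u v; rewrite /e1 -fl; congr f.
  by congr (_, (_, _)); rewrite /= scaler0 addr0.
- move=> u; apply: le_trans (fC _) _; rewrite prod_normE /= normr0 max_r //.
  by rewrite prod_normE /= normr0 max_l.
- move=> a u v; rewrite /e2 -fl; congr f.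
  by congr (_, (_, _)); rewrite /= scaler0 addr0.
- move=> u; apply: le_trans (fC _) _; rewrite prod_normE /= normr0 max_r //.
  by rewrite prod_normE /= normr0 max_r.
Qed.

Let emb0 : emb z0 = (z0.2 - ybar, 0).
Proof. by rewrite /emb subrr. Qed.

Let pen_emb0 : pen (emb z0) = `|z0.2 - ybar|.
Proof. by rewrite emb0 /pen /= !normr0 mulr0 maxxx mulr0 addr0. Qed.

(* Convexity of [pen] turns minimality along [Omega] into minimality along the
   whole tangent direction. *)
Let tangent_min s : clarke_tangent Omega z0 s ->
  pen (emb z0) <= pen (emb z0 + (s.2, s)).
Proof.
move=> Ts; apply/ler_addgt0Pl => e e0.
have [t [w [t0 t1 ws Ow]]] := clarke_tangent_approx Oz0 Ts ltr01 (divr_gt0 e0 M_gt0).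
have E : emb (z0 + t *: w) = (1 - t) *: emb z0 + t *: (emb z0 + (w.2, w)).
  rewrite scalerDr addrA -scalerDl subrK scale1r.
  by apply: injective_projections; rewrite /= addrAC.
have := z0_min Ow; rewrite E.
have := pen_sub.1 ((1 - t) *: emb z0) (t *: (emb z0 + (w.2, w))).
have t1' : 0 <= 1 - t by lra.
rewrite (pen_sub.2 _ _ t1') (pen_sub.2 _ _ (ltW t0)) => h1 h2.
have h3 : pen (emb z0) <= pen (emb z0 + (w.2, w)).
  by rewrite -(ler_pM2l t0); lra.
have := pen_sub.1 (emb z0 + (s.2, s)) ((w - s).2, w - s).
have -> : emb z0 + (s.2, s) + ((w - s).2, w - s) = emb z0 + (w.2, w).
  by rewrite -addrA; congr (_ + _); apply: injective_projections; rewrite /= addrC subrK.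
have := pen_le ((w - s).2, w - s); rewrite prod_normE /= max_r; last exact: (norm_snd (w - s)).
move: ws; rewrite ltr_pdivlMr //; lra.
Qed.

(** Tangent vectors form a convex cone, so every element of the constraint cone is t emb z0 + (s.2,
    s) with [s] tangent, and homogeneity reduces its sign to [tangent_min]. The last clause says
    that -(g1, f + g2) is a Clarke normal. *)
Lemma clarke_multiplier : exists (f : Y -> R) (g1 : X -> R) (g2 : Y -> R),
  [/\ dual f, dual g1, dual g2 & [/\ forall k, f k <= `|k|,
    `|z0.2 - ybar| <= f (z0.2 - ybar),
    forall a b, g1 a + g2 b <= c * Num.max `|a| (gamma * `|b|) &
    forall s, clarke_tangent Omega z0 s -> 0 <= f s.2 + (g1 s.1 + g2 s.2)]].
Proof.
pose T := clarke_tangent Omega z0.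
pose C : set (W * R) := [set h | h = (emb z0, - pen (emb z0)) \/
  exists2 s, T s & h = ((s.2, s), 0)].
have [|f [fl fpen fC]] := @hahn_banach_cone R W pen C pen_sub.
  move=> x r H.
  have [t [s [t0 Ts -> ->]]] : exists t s, [/\ 0 <= t, T s,
      x = t *: emb z0 + (s.2, s) & r = - (t * pen (emb z0))].
    elim: H => [|a h r' x' s' a0 Ch _ [t [s [t0 Ts -> ->]]]].
      exists 0, 0; split=> //; first exact: clarke_tangent0.
        by rewrite scale0r add0r.
      by rewrite mul0r oppr0.
    case: Ch => [[-> ->]|[s1 Ts1 [-> ->]]].
      exists (a + t), s; split=> //; first exact: addr_ge0.
        by rewrite scalerDl addrA.
      by ring.
    exists t, (a *: s1 + s); split=> //.
    - by apply: clarke_tangentD => //; exact: clarke_tangentZ.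
    - by rewrite addrCA; congr (_ + _).
    - by ring.
  rewrite subr_ge0; have [->|tn0] := eqVneq t 0; first by rewrite mul0r.
  have tp : 0 < t by rewrite lt_neqAle eq_sym tn0.
  have ti : 0 <= t^-1 by rewrite invr_ge0.
  have Et : t *: ((t^-1 *: s).2, t^-1 *: s) = (s.2, s).
    by apply: injective_projections; rewrite /= scalerA divff // scale1r.
  have := pen_sub.2 t (emb z0 + ((t^-1 *: s).2, t^-1 *: s)) (ltW tp).
  rewrite scalerDr Et => ->; rewrite ler_pM2l //.
  exact: tangent_min (clarke_tangentZ ti Ts).
have [fd g1d g2d] := split_dual fl (fun h => le_trans (fpen h) (pen_le h)).
exists (ys f), (e1 f), (e2 f); split=> //; split.
- by move=> k; have := fpen (k, 0); rewrite /pen /= !normr0 mulr0 maxxx mulr0 addr0.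
- by rewrite -pen_emb0 /ys -emb0 -[pen _]opprK; apply: fC; left.
- move=> a b; have := fpen (0, (a, b)); rewrite (split_f _ fl) /= /pen /= normr0 add0r.
  by rewrite /ys scalar0 // add0r.
- move=> s Ts; have := fC (s.2, s) 0; rewrite oppr0 split_f //=; apply.
  by right; exists s.
Qed.

(** [emb] is an isometry, since the increment of its second coordinate dominates that of the first.
    Completeness of [Omega] thus passes to the image, where [fuzzy_minimum] applies. *)
Lemma frechet_multiplier eps : separable_duals (R := R) (W := X) ->
  separable_duals (R := R) (W := Y) ->
  cauchy_complete (fun x y : X * Y => `|x - y|) Omega -> 0 < eps ->
  exists (z : X * Y) (f : Y -> R) (g1 : X -> R) (g2 : Y -> R),
  [/\ Omega z, `|z - z0| < eps, [/\ dual f, dual g1 & dual g2] &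
    [/\ forall k, f k <= (1 + eps) * `|k|,
    `|z.2 - ybar| - eps * (1 + eps) <= f (z.2 - ybar),
    forall a b, g1 a + g2 b <= c * Num.max `|a| (gamma * `|b|) +
      eps * Num.max `|a| `|b| &
    forall e : R, 0 < e -> exists2 del : R, 0 < del & forall z', Omega z' ->
      `|z' - z| < del -> - (e * `|z' - z|) <=
      f (z' - z).2 + (g1 (z' - z).1 + g2 (z' - z).2)]].
Proof.
move=> aX aY Ocomp eps0.
have aW : separable_duals (R := R) (W := W).
  by apply: separable_duals_prod => //; exact: separable_duals_prod.
have embB z z' : emb z - emb z' = ((z - z').2, z - z').
  by apply: injective_projections; rewrite /= opprB subrKA.
have embN z z' : `|emb z - emb z'| = `|z - z'|.
  by rewrite embB prod_normE /= max_r //; exact: (norm_snd (z - z')).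
have Ecomp : cauchy_complete (fun x y : W => `|x - y|) (emb @` Omega).
  move=> u hu uC; have /choice [v hv] : forall n, exists z, Omega z /\ emb z = u n.
    by move=> n; have [z Oz zu] := hu n; exists z.
  have Ov n : Omega (v n) by case: (hv n).
  have ev n : emb (v n) = u n by case: (hv n).
  have [|z Oz vz] := Ocomp v Ov.
    move=> e e0; have [N hN] := uC e e0; exists N => m n Nm Nn.
    by rewrite -embN !ev; exact: hN.
  exists (emb z); first by exists z.
  by move=> e e0; have [N hN] := vz e e0; exists N => n /hN; rewrite -ev embN.
have E0 : (emb @` Omega) (emb z0) by exists z0.
have Emin w : (emb @` Omega) w -> pen (emb z0) <= pen w.
  by move=> [z Oz <-]; exact: z0_min.
have [_ [f [[z Oz <-] wz0 [fl fpen fw ff]]]] :=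
  fuzzy_minimum pen_sub pen_ge0 pen_le M_gt0 eps0 aW Ecomp E0 Emin.
have [|fd g1d g2d] := @split_dual f (M + eps) fl.
  by move=> h; apply: le_trans (fpen h) _; rewrite mulrDl lerD2r.
rewrite embN in wz0.
have g_le a b : e1 f a + e2 f b <= c * Num.max `|a| (gamma * `|b|) +
      eps * Num.max `|a| `|b|.
  have := fpen (0, (a, b)); rewrite (split_f _ fl) /= /pen /= normr0 add0r /ys scalar0 //.
  rewrite add0r; suff -> : `|(0 : Y, (a, b))| = Num.max `|a| `|b| by [].
  by rewrite prod_normE /= normr0 max_r // prod_normE.
exists z, (ys f), (e1 f), (e2 f); split=> //; split=> //.
- move=> k; have := fpen (k, 0); rewrite /pen /= !normr0 mulr0 maxxx mulr0 addr0.
  suff -> : `|(k, 0 : X * Y)| = `|k| by rewrite /ys; lra.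
  by rewrite prod_normE /= normr0 max_l.
(* The part of (g1, g2) is removed by [g_le] at z - z0, at a cost of eps |z - z0| <= eps^2. *)
- move: fw; rewrite (split_f (emb z) fl) /= /pen /=.
  have := g_le (z - z0).1 (z - z0).2; rewrite -prod_normE.
  have : eps * `|z - z0| <= eps * eps by rewrite ler_pM2l // ltW.
  by rewrite /=; lra.
move=> e e0; have [del del0 hdel] := ff e e0; exists del => // z' Oz' hz'.
have := hdel (emb z') (ex_intro2 _ _ z' Oz' erefl); rewrite embN => /(_ hz').
by rewrite embB (split_f _ fl).
Qed.

End GraphMinimum.

(** * Normal cone conditions *)

Section NormalConeConditions.
Context {R : realType}.

Lemma frechet_normal_of (Z : normedModType R) (Omega : set Z) z (f : Z -> R) :
  dual f ->
  (forall e : R, 0 < e -> exists2 del : R, 0 < del & forall z', Omega z' ->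
     `|z' - z| < del -> f (z' - z) <= e * `|z' - z|) ->
  frechet_normal Omega z f.
Proof.
move=> fd H; split=> //; apply/lee_addgt0Pr => e e0; rewrite add0e.
have [del del0 hdel] := H e e0.
rewrite limf_esupE; pose V := [set z' | [/\ Omega z', z' <> z & `|z' - z| < del]].
apply: (@le_trans _ _ (ereal_sup [set (f (z' - z) / `|z' - z|)%:E | z' in V])).
  apply: ereal_inf_lbound; exists V => //.
  have := nbhsx_ballx z _ del0; rewrite -ball_normE /=.
  apply: filterS => z' /= zz' [Oz' ne]; split=> //; by rewrite distrC.
apply: ge_ereal_sup => _ [z' [Oz' ne zz'] <-]; rewrite lee_fin.
rewrite ler_pdivrMr ?normr_gt0 ?subr_eq0; [exact: hdel | exact/eqP].
Qed.

Lemma eball_open (X : metricType R) (z x : X) (r : \bar R) : eball z r x ->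
  exists2 e : R, 0 < e & forall u, mdist x u < e -> eball z r u.
Proof.
rewrite /eball /=; case: r => [r| |//].
  rewrite lte_fin => xr; exists (r - mdist z x); first by rewrite subr_gt0.
  move=> u xu; rewrite lte_fin; have := metric_triangle z x u; lra.
by move=> _; exists 1 => // u _; rewrite ltry.
Qed.

(** A fuzzy minimum is found only near (x, y), so (R) has to persist there. The condition on
    F_p^{-1}(ybar) persists because the closed graph misses a neighborhood of (x, ybar). *)
Lemma req_open (P X Y : metricType R) (F : P -> X -> set Y) pbar xbar ybar
    (l l' : R) (eta delta mu : \bar R) p x y :
  closed (gph (F p)) -> req F pbar xbar ybar l l' eta delta mu p x y ->
  exists2 r : R, 0 < r & forall u v, F p u v -> mdist x u < r -> mdist y v < r ->
    req F pbar xbar ybar l l' eta delta mu p u v.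
Proof.
move=> Fc [bp bx nF Fxy byy].
have [r1 r10 h1] := eball_open bx; have [r2 r20 h2] := eball_open byy.
have [r3 r30 h3] := closed_avoid Fc (nF : ~ gph (F p) (x, ybar)).
exists (Num.min r1 (Num.min r2 r3)); first by rewrite !lt_min r10 r20.
move=> u v Fuv; rewrite !lt_min => /and3P[u1 _ u3] /and3P[_ v2 _]; split=> //.
- exact: h1.
- by apply: h3 => //; rewrite mdistxx.
- exact: h2.
Qed.

Section Banach.
Context {P : metricType R} {X Y : banachType R}.
Variables (F : P -> X -> set Y) (pbar : P) (xbar : X) (ybar : Y).
Variables (l l' : R) (eta delta mu : \bar R).
Hypotheses (l_gt0 : 0 < l) (l'_gt0 : 0 < l') (eta_gt0 : (0 < eta)%E)
  (F_closed : forall p, eball pbar eta p -> closed (gph (F p)))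
  (F_rec : recedes F pbar xbar ybar l' eta delta mu).

Let conclusion := aubin (fun p => [set x | F p x ybar]) pbar xbar l eta delta mu.
Let reqF := req F pbar xbar ybar l l' eta delta mu.

(** The vanishing differences are kept so that the hypothesis unfolds to minimality of [pen] at
    [emb (x, y)]. Moreover y differs from ybar because (x, ybar) is not in the graph. *)
Let reduce gamma : 0 < gamma ->
  (forall p x y c, reqF p x y -> 0 < c -> c < l' / l -> 0 < `|y - ybar| ->
     (forall z, gph (F p) z ->
       `|(x, y).2 - ybar| + c * Num.max `|((x, y) - (x, y)).1|
          (gamma * `|((x, y) - (x, y)).2|) <=
       `|z.2 - ybar| + c * Num.max `|(z - (x, y)).1| (gamma * `|(z - (x, y)).2|)) ->
     False) -> conclusion.
Proof.
move=> g0 H; apply: (aubin_of_no_small_slope l_gt0 l'_gt0 g0 F_closed F_rec).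
move=> p x y c hr c0 cl hmin; apply: (H p x y c) => //.
  rewrite normr_gt0 subr_eq0; apply/eqP => yy.
  by case: hr => _ _ nF Fxy _; apply: nF; rewrite -yy.
move=> [u v] Fuv; have := hmin u v Fuv.
by rewrite /gdist !banach_mdistE /= !subrr !normr0 mulr0 maxxx mulr0 addr0.
Qed.

(** The normal -(g1, f + g2) differs from (0, - f) by (g1, g2) up to sign, of dual size at most c <
    l' / l. *)
Lemma cond_clarke_normal_aubin :
  cond_clarke_normal F pbar xbar ybar l l' eta delta mu -> conclusion.
Proof.
move=> [gamma g0 H]; apply: (reduce g0) => p x y c hr c0 cl D0 hmin.
have [_ _ _ Fxy _] := hr.
have [f [g1 [g2 [fd g1d g2d [f1 fy g_le fT]]]]] :=
  clarke_multiplier c0 g0 (Fxy : gph (F p) (x, y)) hmin.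
have fM k : `|f k| <= 1 * `|k|.
  by apply: (scalar_le_norm fd.1) => b; rewrite mul1r; exact: f1.
have f_norm : dual_norm f = 1.
  apply/eqP; rewrite eq_le; apply/andP; split.
    by apply: dual_norm_le => k k1; apply: le_trans (fM k) _; rewrite mul1r.
  have fn := le_dual_norm (y - ybar) fd.1 fM.
  rewrite -(ler_pM2r D0) mul1r; apply: le_trans fn.
  exact: le_trans fy (ler_norm _).
have f_eq : f (y - ybar) = `|y - ybar| by apply/eqP; rewrite eq_le f1.
have := H p x y f hr fd f_norm f_eq; apply/negP; rewrite -ltNge.
pose s : (X -> R) * (Y -> R) := (\- g1, \- (f \+ g2)).
apply: (@le_lt_trans _ _ (dual_gdist gamma (cst 0, \- f) s)%:E).
  apply: ereal_inf_lbound; exists s => //.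
  have s1d : dual s.1 by exact: dualN.
  have s2d : dual s.2 by apply: dualN; exact: dualD.
  split=> //; split; first exact: dual_pair.
  by move=> w /fT; rewrite /s /=; lra.
rewrite lte_fin /dual_gdist /dual_dist /=.
have -> : (cst 0 \- \- g1 : X -> R) = g1 by apply/funext => a /=; ring.
have -> : (\- f \- \- (f \+ g2) : Y -> R) = g2 by apply/funext => a /=; ring.
apply: le_lt_trans cl.
exact: dual_gdist_le g0 (ltW c0) g1d.1 g2d.1 g_le.
Qed.

Let small_eps D r tau k b : 0 < D -> 0 < r -> tau < 1 -> 0 < k -> 0 < b ->
  exists eps : R, [/\ 0 < eps, eps <= 1, eps <= D / 2, eps <= r &
    eps * (4 + D) < D * (1 - tau) /\ eps * k < b].
Proof.
move=> D0 r0 t1 k0 b0; have t0 : 0 < 1 - tau by rewrite subr_gt0.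
have D4 : 0 < 4 + D by rewrite addr_gt0.
pose q1 := D * (1 - tau) / (4 + D); pose q2 := b / k.
have q10 : 0 < q1 by rewrite divr_gt0 // mulr_gt0.
have q20 : 0 < q2 by rewrite divr_gt0.
pose m := Num.min (Num.min 1 (D / 2)) (Num.min r (Num.min q1 q2)).
have m0 : 0 < m by rewrite !lt_min ltr01 divr_gt0 // r0 q10.
have : m <= m by []; rewrite {2}/m !le_min => /and3P[/andP[m1 m2] m3 /andP[m4 m5]].
exists (m / 2); split; [by rewrite divr_gt0|lra|lra|lra|split].
  by rewrite -ltr_pdivlMr // -/q1; lra.
by rewrite -ltr_pdivlMr // -/q2; lra.
Qed.

Lemma cond_frechet_normal_aubin : asplund X -> asplund Y ->
  cond_frechet_normal F pbar xbar ybar l l' eta delta mu -> conclusion.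
Proof.
move=> aX aY [gamma [tau [g0 tau0 tau1 H]]].
apply: (reduce g0) => p x y c hr c0 cl D0 hmin.
have [bp _ _ Fxy _] := hr; have Fc := F_closed bp.
have [r r0 hr'] := req_open Fc hr.
set D := `|y - ybar| in D0.
have gi : 0 < gamma^-1 by rewrite invr_gt0.
have D40 : 0 < 4 / D by rewrite divr_gt0.
(* Error per unit of [eps]: 1 + gamma^-1 from the extra term in [g_le], and gamma^-1 (1 + 4 / D)
   from normalizing [f], as |n - 1| <= eps (1 + 4 / D). *)
pose k := 1 + gamma^-1 + gamma^-1 * (1 + 4 / D).
have k0 : 0 < k by rewrite /k addr_gt0 ?mulr_gt0 // addr_gt0.
have cl0 : 0 < l' / l - c by rewrite subr_gt0.
have [eps [eps0 eps1 epsD epsr [epst epsk]]] := small_eps D0 r0 tau1 k0 cl0.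
have Ocomp : cauchy_complete (fun a b : X * Y => `|a - b|) (gph (F p)).
  have -> : (fun a b : X * Y => `|a - b|) = gdist 1.
    apply/funext => a; apply/funext => b.
    by rewrite /gdist !banach_mdistE mul1r prod_normE.
  exact: (closed_gdist_complete ltr01 Fc).
have [[u v] [f [g1 [g2 [Fuv nuv [fd g1d g2d] [f1 fy g_le fF]]]]]] :=
  frechet_multiplier c0 g0 (Fxy : gph (F p) (x, y)) hmin
    (asplund_separable_duals aX) (asplund_separable_duals aY) Ocomp eps0.
rewrite /= in fy.
have [nu nv] : `|u - x| < eps /\ `|v - y| < eps.
  by move: nuv; rewrite prod_normE /= gt_max => /andP[].
have huv : reqF p u v.
  apply: hr' => //; rewrite banach_mdistE distrC; exact: lt_le_trans epsr.
set m := `|v - ybar| in fy.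
have mD : D / 2 <= m.
  have : D <= m + `|v - y|.
    by have := ler_normD (y - v) (v - ybar); rewrite subrKA (distrC y v) /D /m; lra.
  lra.
have m0 : 0 < m by apply: lt_le_trans mD; rewrite divr_gt0.
have fM b : `|f b| <= (1 + eps) * `|b| by apply: scalar_le_norm fd.1 f1 b.
pose n := dual_norm f.
have n_le : n <= 1 + eps.
  apply: dual_norm_le => b b1; apply: le_trans (fM b) _.
  by rewrite ler_piMr // addr_ge0 // ltW.
have fn b : `|f b| <= n * `|b| by exact: le_dual_norm fd.1 fM.
have fy2 : m - 2 * eps <= f (v - ybar).
  apply: le_trans fy; have : eps * eps <= eps * 1 by rewrite ler_pM2l.
  lra.
have nm : f (v - ybar) <= n * m by apply: le_trans (ler_norm _) (fn _).
have n_ge : 1 - eps * (4 / D) <= n.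
  rewrite -(ler_pM2r m0); apply: le_trans nm; apply: le_trans fy2.
  have h := ler_wpM2l (ltW (mulr_gt0 eps0 D40)) mD.
  have E : eps * (4 / D) * (D / 2) = 2 * eps by field; rewrite gt_eqF.
  by rewrite E in h; rewrite mulrBl mul1r; lra.
(* With m >= D / 2, the choice eps (4 + D) < D (1 - tau) gives m (1 - tau - eps) > 2 eps. The factor
   1 + eps allows for the later division by [n]. *)
have big : tau * ((1 + eps) * m) < f (v - ybar).
  apply: lt_le_trans fy2.
  have h1 : 0 < 1 - tau - eps.
    rewrite -(pmulr_rgt0 _ D0); have : 0 < eps * 4 by rewrite mulr_gt0.
    lra.
  have h2 := ler_wpM2r (ltW h1) mD.
  have h3 : tau * (eps * m) <= 1 * (eps * m).
    by rewrite ler_wpM2r ?ltW // mulr_gt0.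
  lra.
have n0 : 0 < n.
  rewrite -(pmulr_lgt0 _ m0); apply: lt_le_trans nm; apply: le_lt_trans big.
  by rewrite mulr_ge0 ?ltW // mulr_gt0 // addr_gt0.
pose h b := n^-1 * f b.
have hl : scalar h by move=> a b b'; rewrite /h fd.1 /=; ring.
have hM b : `|h b| <= 1 * `|b|.
  by rewrite /h normrM gtr0_norm ?invr_gt0 // ler_pdivrMl // mul1r.
have hd : dual h.
  by apply: (dual_of_le (M := 1) hl) => b; apply: le_trans (ler_norm _) (hM b).
have h_norm : dual_norm h = 1.
  apply/eqP; rewrite eq_le; apply/andP; split.
    by apply: dual_norm_le => b b1; apply: le_trans (hM b) _; rewrite mul1r.
  rewrite -(ler_pM2l n0) mulr1; apply: dual_norm_le => b b1.
  have := le_dual_norm b hl hM; rewrite /h normrM gtr0_norm ?invr_gt0 //.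
  rewrite ler_pdivrMl // => /le_trans; apply; rewrite mulrA ler_piMr //.
  by rewrite mulr_ge0 ?dual_norm_ge0 // ltW.
have hy : tau * `|v - ybar| < h (v - ybar).
  rewrite /h ltr_pdivlMl //; apply: le_lt_trans big; rewrite mulrCA ler_pM2l //.
  by rewrite ler_pM2r.
have := H p u v h huv hd h_norm hy; apply/negP; rewrite -ltNge.
pose s : (X -> R) * (Y -> R) := (\- g1, \- (f \+ g2)).
apply: (@le_lt_trans _ _ (dual_gdist gamma (cst 0, \- h) s)%:E).
  apply: ereal_inf_lbound; exists s => //.
  have s1d : dual s.1 by exact: dualN.
  have s2d : dual s.2 by apply: dualN; exact: dualD.
  split=> //; apply: frechet_normal_of; first exact: dual_pair.
  move=> e /fF [del del0 hdel]; exists del => // z' Fz' zz'.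
  by have := hdel z' Fz' zz'; rewrite /s /=; lra.
rewrite lte_fin /dual_gdist /dual_dist /=.
have -> : (cst 0 \- \- g1 : X -> R) = g1 by apply/funext => a /=; ring.
have -> : (\- h \- \- (f \+ g2) : Y -> R) = (f \- h) \+ g2.
  by apply/funext => a /=; ring.
have C0 : 0 <= c + eps * k by rewrite addr_ge0 ?mulr_ge0 // ltW.
apply: (@le_lt_trans _ _ (c + eps * k)); last by lra.
apply: (dual_gdist_le g0 C0 g1d.1).
  by apply: (dualD (dualD fd (dualN hd)) g2d).1.
move=> a b; have := g_le a b; set Mx := Num.max `|a| (gamma * `|b|).
have Ma : `|a| <= Mx by rewrite /Mx le_max lexx.
have Mb : `|b| <= gamma^-1 * Mx by rewrite ler_pdivlMl // /Mx le_max lexx orbT.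
have Mx0 : 0 <= Mx by exact: le_trans Ma.
have gMx : 0 <= gamma^-1 * Mx by rewrite mulr_ge0 // ltW.
have Mab : Num.max `|a| `|b| <= (1 + gamma^-1) * Mx.
  by rewrite ge_max; apply/andP; split; lra.
have fh : f b - h b <= eps * (1 + 4 / D) * (gamma^-1 * Mx).
  have -> : f b - h b = (n - 1) * h b.
    by rewrite /h mulrBl mulrA divff ?gt_eqF // !mul1r.
  apply: le_trans (ler_norm _) _; rewrite normrM; apply: ler_pM => //.
    have : 0 < eps * (4 / D) by rewrite mulr_gt0.
    by rewrite ler_norml mulrDr mulr1; lra.
  by apply: le_trans (hM b) _; rewrite mul1r.
have := ler_wpM2l (ltW eps0) Mab.
rewrite /k /=; move: (gamma^-1) (4 / D) (f b) (h b) fh => gg dd f' h' fh; lra.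
Qed.

(** For a normal pair (s1, s2), either - s2 is within [eta] of [ys], so that s1 is in the
    coderivative image and has norm at least [k]; or the second component alone contributes gamma^-1
    eta >= k. *)
Lemma coderivative_normal_dist (N : set (X * Y) -> X * Y -> set (X * Y -> R))
    (Phi : X -> set Y) x y (ys : Y -> R) (gamma k : R) :
  0 < gamma -> ((gamma * k)%:E <= eta)%E ->
  (k%:E <= set_dist (@dual_dist R X) (cst 0%R)
        (coderivative_image N Phi x y (dual_ball ys eta)))%E ->
  (k%:E <= set_dist (dual_gdist gamma) (cst 0, \- ys)%R
        (dual_pairs (N (gph Phi) (x, y))))%E.
Proof.
move=> g0 geta hk; apply: le_ereal_inf_tmp => _ [[s1 s2] [/= s1d s2d Ns] <-].
rewrite lee_fin /dual_gdist /=.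
have gi : 0 < gamma^-1 by rewrite invr_gt0.
have [near|far] := ltP (dual_dist ys (\- s2))%:E eta.
  apply: (@le_trans _ _ (dual_dist (cst 0) s1)); last first.
    by rewrite lerDl; apply: mulr_ge0 (ltW gi) (dual_norm_ge0 _).
  rewrite -lee_fin; apply: le_trans hk _; apply: ereal_inf_lbound.
  exists s1 => //; exists (\- s2); first by split=> //; exact: dualN.
  have E : \- (\- s2) = s2 by apply/funext => b /=; rewrite opprK.
  by rewrite /coderivative /= E.
have : gamma * k <= dual_dist (\- ys) s2.
  rewrite -lee_fin; apply: le_trans geta _; apply: le_trans far _.
  rewrite lee_fin /dual_dist -dual_normN.
  suff -> : \- (ys \- \- s2) = (\- ys \- s2) by [].
  by apply/funext => b /=; ring.
rewrite -ler_pdivlMl // => h; apply: le_trans h _.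
by rewrite lerDr dual_norm_ge0.
Qed.

Let exists_gamma : exists2 gamma : R, 0 < gamma & ((gamma * (l' / l))%:E <= eta)%E.
Proof.
have ll0 : 0 < l' / l by rewrite divr_gt0.
case: eta eta_gt0 => [r| |//] r0; last by exists 1; rewrite // leey.
by exists (r / (l' / l)); rewrite ?divr_gt0 // lee_fin divfK // gt_eqF.
Qed.

Lemma cond_clarke_coderivative_aubin :
  cond_clarke_coderivative F pbar xbar ybar l l' eta delta mu -> conclusion.
Proof.
move=> H; have [gamma g0 geta] := exists_gamma.
apply: cond_clarke_normal_aubin; exists gamma => // p x y ys hr ysd ys1 ysy.
exact: coderivative_normal_dist g0 geta (H p x y ys hr ysd ys1 ysy).
Qed.

Lemma cond_frechet_coderivative_aubin : asplund X -> asplund Y ->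
  cond_frechet_coderivative F pbar xbar ybar l l' eta delta mu -> conclusion.
Proof.
move=> aX aY [tau [tau0 tau1 H]]; have [gamma g0 geta] := exists_gamma.
apply: cond_frechet_normal_aubin => //; exists gamma, tau; split=> //.
move=> p x y ys hr ysd ys1 ysy.
exact: coderivative_normal_dist g0 geta (H p x y ys hr ysd ys1 ysy).
Qed.

End Banach.
End NormalConeConditions.

Theorem proposition5p12 (R : realType) (P : metricType R) (pbar : P)
  (l : R) (eta delta mu : \bar R)
  (l_gt0 : 0 < l) (eta_gt0 : (0 < eta)%E) (delta_gt0 : (0 < delta)%E)
  (mu_gt0 : (0 < mu)%E) :
  (* complete metric spaces: condition (i) *)
  (forall (X Y : completeMetricType R) (F : P -> X -> set Y)
     (xbar : X) (ybar : Y),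
     F pbar xbar ybar ->
     (forall p, eball pbar eta p -> closed (gph (F p))) ->
     (exists2 l' : R, 0 < l' &
        recedes F pbar xbar ybar l' eta delta mu /\
        cond_slope F pbar xbar ybar l l' eta delta mu) ->
     aubin (fun p => [set x | F p x ybar]) pbar xbar l eta delta mu) /\
  (* Banach spaces: conditions (ii)-(v) *)
  (forall (X Y : banachType R) (F : P -> X -> set Y) (xbar : X) (ybar : Y),
     F pbar xbar ybar ->
     (forall p, eball pbar eta p -> closed (gph (F p))) ->
     (exists2 l' : R, 0 < l' &
        recedes F pbar xbar ybar l' eta delta mu /\
        [\/ cond_clarke_normal F pbar xbar ybar l l' eta delta mu,
            [/\ asplund X, asplund Y &
                cond_frechet_normal F pbar xbar ybar l l' eta delta mu],
            cond_clarke_coderivative F pbar xbar ybar l l' eta delta mu |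
            [/\ asplund X, asplund Y &
                cond_frechet_coderivative F pbar xbar ybar l l' eta delta mu]]) ->
     aubin (fun p => [set x | F p x ybar]) pbar xbar l eta delta mu).
Proof.
split=> X Y F xbar ybar _ Fc [l' l'0 [rec H]].
  exact: cond_slope_aubin l_gt0 l'0 Fc rec H.
case: H => [H|[aX aY H]|H|[aX aY H]].
- exact: cond_clarke_normal_aubin l_gt0 l'0 Fc rec H.
- exact: cond_frechet_normal_aubin l_gt0 l'0 Fc rec aX aY H.
- exact: cond_clarke_coderivative_aubin l_gt0 l'0 eta_gt0 Fc rec H.
- exact: cond_frechet_coderivative_aubin l_gt0 l'0 eta_gt0 Fc rec aX aY H.
Qed.
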